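(* Let $\mathcal E$ be a class of superreflexive Banach spaces closed under finite representability. If a locally compact compactly generated group $H$ has (F$_{\mathcal E}$), then $H$ is the quotient, by a discrete normal subgroup, of a compactly presented locally compact group with (F$_{\mathcal E}$).
   Context: A group has (F$_{\mathcal E}$) if every continuous affine isometric action of it on a space in $\mathcal E$ has a fixed point. A Banach space $X$ is finitely representable in a class $\mathcal E$ if for every finite dimensional subspace $Y\subset X$ and every $\varepsilon>0$, $Y$ is at (multiplicative) Banach–Mazur distance less than $1+\varepsilon$ from a subspace of a space in $\mathcal E$. $\mathcal E$ is closed under finite representability if every Banach space finitely representable in $\mathcal E$ belongs to $\mathcal E$. A Banach space (or class) is superreflexive if every Banach space finitely representable in it is reflexive. A locally compact group with compact generating set $S$ is compactly presented if, as an abstract group, it has a presentation with $S$ as set of generators and relators of bounded length (this does not depend on $S$). *)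

(* Defs.v *)
From HB Require Import structures.
From mathcomp Require Import all_boot all_order all_algebra.
From mathcomp Require Import all_classical all_reals all_analysis.
Set Implicit Arguments.
Unset Strict Implicit.
Unset Printing Implicit Defensive.
Import Order.TTheory GRing.Theory Num.Theory.
Import numFieldNormedType.Exports.
Local Open Scope classical_set_scope.
Local Open Scope ring_scope.

(* A class of Banach spaces is a predicate on completeNormedModType R; set
   would not do, for universe reasons. *)

Definition linear_on (R : realType) (V W : lmodType R) (A : set V)
    (T : V -> W) : Prop :=
  forall a, {in A &, forall x y, T (a *: x + y) = a *: T x + T y}.

Definition finite_dimensional (R : realType) (V : lmodType R) (Y : set V) :=
  exists n (v : 'I_n -> V),
    Y = [set x | exists a : 'I_n -> R, x = \sum_(i < n) a i *: v i].

(* +oo when T is unbounded on the unit ball of A *)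
Definition opnorm (R : realType) (V W : normedModType R) (A : set V)
    (T : V -> W) : \bar R :=
  ereal_sup [set `|T x|%:E | x in A `&` [set x | `|x| <= 1]].

(* Only the values of T on Y and of its inverse T' on Z matter; the distance
   is +oo when Y and Z are not isomorphic. *)
Definition Banach_Mazur (R : realType) (V W : normedModType R) (Y : set V)
    (Z : set W) : \bar R :=
  ereal_inf [set d | exists (T : V -> W) (T' : W -> V),
    [/\ linear_on Y T, set_bij Y Z T, {in Y, cancel T T'} &
        d = (opnorm Y T * opnorm Z T')%E]].

Definition finitely_representable (R : realType)
    (E : completeNormedModType R -> Prop) (X : completeNormedModType R) : Prop :=
  forall Y : set X, submod_closed [in Y] -> finite_dimensional Y ->
  forall eps : R, 0 < eps ->
  exists X' : completeNormedModType R, E X' /\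
    exists Z : set X',
      submod_closed [in Z] /\ (Banach_Mazur Y Z < (1 + eps)%:E)%E.

Definition closed_under_finite_representability (R : realType)
    (E : completeNormedModType R -> Prop) : Prop :=
  forall X, finitely_representable E X -> E X.

Definition dual (R : realType) (X : normedModType R) : set (X -> R^o) :=
  [set f | linear f /\ continuous f].
Arguments dual {R} X _.

(* The canonical embedding of X into its bidual is onto; an element of the
   bidual is represented by a function phi whose values off the dual of X are
   irrelevant. *)
Definition reflexive_space (R : realType) (X : normedModType R) : Prop :=
  forall phi : (X -> R^o) -> R^o,
    linear_on (dual X) phi ->
    (exists C : R, forall f, dual X f ->
       (`|phi f|%:E <= C%:E * opnorm setT f)%E) ->
  exists x : X, forall f, dual X f -> phi f = f x.

Definition superreflexive_class (R : realType)
    (E : completeNormedModType R -> Prop) : Prop :=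
  forall X, finitely_representable E X -> reflexive_space X.

Definition superreflexive (R : realType) (X : completeNormedModType R) : Prop :=
  superreflexive_class (fun Y => Y = X).

Local Open Scope group_scope.

HB.structure Definition PreTopologicalGroup :=
  {G of Topological G & Group G}.

HB.mixin Record PreTopologicalGroup_isTopologicalGroup G
    of PreTopologicalGroup G := {
  mulg_continuous : continuous (fun x : G * G => x.1 * x.2);
  invg_continuous : continuous (fun x : G => x^-1)
}.

#[short(type="topologicalGroupType")]
HB.structure Definition TopologicalGroup :=
  {G of PreTopologicalGroup G & PreTopologicalGroup_isTopologicalGroup G}.

Definition locally_compact_group (G : topologicalGroupType) : Prop :=
  hausdorff_space G /\ locally_compact [set: G].

(* (false, s) is the letter s and (true, s) its formal inverse *)
Definition word (A : Type) := seq (bool * A).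

Definition eval_word (G : groupType) (S : set G) (w : word S) : G :=
  \prod_(l <- w) (if l.1 then (val l.2)^-1 else val l.2).

(* Equality in the group with generators A and relators rel *)
Inductive presented_eq (A : Type) (rel : set (word A)) :
    word A -> word A -> Prop :=
| presented_refl w : presented_eq rel w w
| presented_sym w w' : presented_eq rel w w' -> presented_eq rel w' w
| presented_trans w w' w'' :
    presented_eq rel w w' -> presented_eq rel w' w'' -> presented_eq rel w w''
| presented_cancel u v b a :
    presented_eq rel (u ++ [:: (b, a); (~~ b, a)] ++ v) (u ++ v)
| presented_relator u v r :
    rel r -> presented_eq rel (u ++ r ++ v) (u ++ v).

Definition generating (G : groupType) (S : set G) : Prop :=
  forall g, exists w : word S, eval_word w = g.

(* The canonical map from the presented group to G is an isomorphism. *)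
Definition presentation (G : groupType) (S : set G) (rel : set (word S)) :=
  generating S /\
  forall w w' : word S, eval_word w = eval_word w' <-> presented_eq rel w w'.

Definition compactly_generated (G : topologicalGroupType) : Prop :=
  exists S : set G, compact S /\ generating S.

Definition compactly_presented (G : topologicalGroupType) : Prop :=
  exists S : set G, compact S /\
    exists (rel : set (word S)) (n : nat),
      (forall r, rel r -> (size r <= n)%N) /\ presentation rel.

Definition affine_map (R : realType) (X : lmodType R) (f : X -> X) : Prop :=
  forall (t : R) (x y : X),
    f (t *: x + (1 - t) *: y)%R = (t *: f x + (1 - t) *: f y)%R.

Definition affine_isometric_action (R : realType) (G : groupType)
    (X : normedModType R) (alpha : G -> X -> X) : Prop :=
  [/\ forall x, alpha 1 x = x,
      forall g h x, alpha (g * h) x = alpha g (alpha h x),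
      forall g, affine_map (alpha g) &
      forall g x y, `|alpha g x - alpha g y|%R = `|x - y|%R].

Definition property_F (R : realType) (E : completeNormedModType R -> Prop)
    (G : topologicalGroupType) : Prop :=
  forall X : completeNormedModType R, E X ->
  forall alpha : G -> X -> X,
    affine_isometric_action alpha ->
    continuous (fun p : G * X => alpha p.1 p.2) ->
  exists x : X, forall g, alpha g x = x.

Definition normal_subgroup (G : groupType) (N : set G) : Prop :=
  group_closed [in N] /\ forall x y, N x -> N (x ^ y).

Definition discrete_subset (T : topologicalType) (A : set T) : Prop :=
  A `<=` isolated A.

(* H is isomorphic to G / N as a group, and carries the quotient topology. *)
Definition is_quotient (G H : topologicalGroupType) (N : set G) : Prop :=
  exists pi : G -> H,
    [/\ {morph pi : x y / x * y}, range pi = setT, pi @^-1` [set 1] = N &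
        forall U : set H, open U <-> open (pi @^-1` U)].

(* Main.v *)
Require Import Defs.
From HB Require Import structures.
From mathcomp Require Import all_boot all_order all_algebra.
Set Implicit Arguments.
Unset Strict Implicit.
Unset Printing Implicit Defensive.
Import Order.TTheory GRing.Theory Num.Theory.

(** The compactly generated group [H] is the direct limit of the groups [G_n]
    presented by a compact generating neighbourhood [S] of 1 and the relators of
    length at most [n] of [H]; for [n] large, [G_n] carries a locally compact
    group topology for which [G_n -> H] is a local homeomorphism.  If no [G_n]
    had (F_E), pick fixed-point-free actions of the [G_n] on spaces of [E], base
    points around which, in balls of large radius, the displacement by [S] stays
    comparable to its value at the base point, and rescale that displacement to
    1.  The ultraproduct of these affine spaces is finitely representable in [E]
    and [H] acts on it without fixed point; only the continuity of the limit
    action requires care.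

    Continuity is gained by replacing each base point by an average of its
    orbit over a neighbourhood of 1, which makes the orbit maps of the base
    points equicontinuous, and by retaining in the ultraproduct only the
    sequences with equicontinuous orbits.  Averages are taken over minimal
    covers of nested neighbourhoods [A_0], [A_1], ... of 1 by translates of a
    tiny neighbourhood of 1: Hall's theorem matches a minimal cover of [A_i],
    and its translate by a small element, with parts of a minimal cover of a
    slightly larger [A_j], and the defects telescope. *)

(** Continuity of each action gives a neighbourhood of 1 that moves the base point little, but this
    neighbourhood depends on the action, so nothing of it survives in the limit. Averages repair
    this because their modulus of continuity does not depend on it: the tiny neighbourhood only
    serves as a unit of measure, the size of a minimal cover by its translates playing the role of
    Haar measure. The one constant that enters is a ratio of such sizes, bounded by the size of a
    cover [hs] of a compact [K] by translates of [V 0], chosen in [H] before the actions. An element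
    of [V k] shifts the nested family by a proportion 2^-k of its length, hence disturbs a
    proportion of order 2^-k of the average. Averaging moves the base point by at most twice the
    rescaling unit, so the lower bound on displacements persists in large balls around the new one.
    All actions are compared on [H] through sections [H -> G_n] given by shortest words. These are
    multiplicative only on elements of bounded length, with a bound growing with [n], so [H] acts
    only in the limit. *)

(** * Hall's marriage theorem *)

Section hall.
Variables (A B : finType) (r : A -> B -> bool) (b0 : B).
Implicit Types (D T : {set A}) (E : {set B}).
Local Open Scope nat_scope.

Let N E T : {set B} := [set b in E | [exists a in T, r a b]].

Let NP E T b : reflect (b \in E /\ exists2 a, a \in T & r a b) (b \in N E T).
Proof.
rewrite inE; apply: (iffP andP) => -[bE h]; split=> //.
  by have [a /andP[]] := existsP h; exists a.
by have [a aT ab] := h; apply/existsP; exists a; rewrite aT.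
Qed.

(** Induction of Halmos and Vaughan: a proper nonempty [T] with no more neighbours than elements
    splits the problem into [T] against its neighbours and the rest against the other vertices; if
    there is none, any edge can be matched and removed. Subsets [D] and [E] of fixed types keep the
    smaller problems in the same form; [b0] fills the values outside [D]. *)
Lemma hall_matching_in n D E : #|D| <= n ->
  (forall T, T \subset D -> #|T| <= #|N E T|) ->
  exists f : A -> B, {in D &, injective f} /\ {in D, forall a, r a (f a) && (f a \in E)}.
Proof.
elim: n D E => [|n IH] D E Dn hallD.
  exists (fun=> b0); move: Dn; rewrite leqn0 cards_eq0 => /eqP ->.
  by split=> [x y|x]; rewrite inE.
have [->|[a aD]] := set_0Vmem D.
  by exists (fun=> b0); split=> [x y|x]; rewrite inE.
have [/existsP [T /and4P[TD T0 TnD TN]]|] :=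
  boolP [exists T : {set A}, [&& T \subset D, T != set0, T != D & #|N E T| <= #|T|]].
- have Tlt : #|T| < #|D| by apply: proper_card; rewrite properEneq TnD.
  have [|T' T'T|f1 [f1i f1P]] := IH T (N E T); first by rewrite -ltnS (leq_trans Tlt).
    apply: leq_trans (hallD _ (subset_trans T'T TD)) _; apply: subset_leq_card.
    apply/subsetP => b /NP[bE [a' a'T ab]]; apply/NP; split; last by exists a'.
    by apply/NP; split=> //; exists a' => //; exact: (subsetP T'T).
  have DT : #|D :\: T| <= n.
    rewrite cardsD (setIidPr TD) -ltnS; apply: leq_trans Dn.
    by rewrite ltn_subrL card_gt0 T0 (leq_ltn_trans _ Tlt).
  (* Hall's condition for [T' :|: T] yields that for [T'] in the rest, since [T] has at most [#|T|]
     neighbours. *)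
  have [T' T'D|f2 [f2i f2P]] := IH (D :\: T) (E :\: N E T) DT.
    have TT' : [disjoint T' & T].
      rewrite disjoint_subset; apply/subsetP => x /(subsetP T'D).
      by rewrite !inE => /andP[].
    have h : #|T' :|: T| <= #|N E (T' :|: T)|.
      by apply: hallD; rewrite subUset TD andbT (subset_trans T'D) ?subsetDl.
    rewrite cardsU (_ : T' :&: T = set0) ?cards0 ?subn0 in h; last first.
      by apply/eqP; rewrite setI_eq0.
    have sub : N E (T' :|: T) \subset N (E :\: N E T) T' :|: N E T.
      apply/subsetP => b /NP[bE [x xT xb]]; rewrite in_setU.
      case: (boolP (b \in N E T)) => [_|bn]; first by rewrite orbT.
      rewrite orbF; apply/NP; rewrite in_setD bn bE; split=> //; exists x => //.
      move: xT; rewrite in_setU => /orP[//|xT]; case/negP: bn; apply/NP.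
      by split=> //; exists x.
    have := leq_trans h (leq_trans (subset_leq_card sub) (leq_card_setU _ _)).
    by move=> h'; rewrite -(leq_add2r #|T|); apply: leq_trans h' _; rewrite leq_add2l.
  exists (fun x => if x \in T then f1 x else f2 x); split=> [x y xD yD|x xD].
    case: ifPn => xT; case: ifPn => yT.
    + exact: f1i.
    + move=> e; have /andP[_ h1] := f1P _ xT.
      have /f2P /andP[_] : y \in D :\: T by rewrite in_setD yT.
      by rewrite -e in_setD h1.
    + move=> e; have /andP[_ h1] := f1P _ yT.
      have /f2P /andP[_] : x \in D :\: T by rewrite in_setD xT.
      by rewrite e in_setD h1.
    + by apply: f2i; rewrite in_setD ?xT ?yT.
  case: ifPn => xT.
    by have /andP[-> /NP[]] := f1P _ xT.
  have /f2P /andP[->] : x \in D :\: T by rewrite in_setD xT.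
  by rewrite in_setD => /andP[].
- move=> /existsPn tight.
  have [b bN] : exists b, b \in N E [set a].
    apply/set0Pn; rewrite -card_gt0; apply: leq_trans (hallD [set a] _).
      by rewrite cards1.
    by rewrite sub1set.
  have /NP[bE [a' + ab]] := bN; rewrite in_set1 => /eqP ea; subst a'.
  have Da : #|D :\ a| <= n by rewrite -ltnS; move: Dn; rewrite (cardsD1 a) aD.
  have [T TD|f [fi fP]] := IH (D :\ a) (E :\ b) Da.
    have [->|T0] := eqVneq T set0; first by rewrite cards0.
    have := tight T; rewrite T0 (subset_trans TD) ?subsetDl //=.
    have -> /= : T != D.
      apply/eqP => e; have := subsetP TD a; rewrite e aD in_setD1 eqxx.
      by move/(_ isT).
    (* The surplus of one neighbour compensates for the removal of [b]. *)
    rewrite -ltnNge => h; rewrite -ltnS; apply: leq_trans h _.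
    have sub : N E T \subset b |: N (E :\ b) T.
      apply/subsetP => c /NP[cE [x xT xc]]; rewrite in_setU1.
      case: eqVneq => //= cb; apply/NP; rewrite in_setD1 cb; split=> //.
      by exists x.
    apply: leq_trans (subset_leq_card sub) _; rewrite cardsU1.
    by case: (_ \notin _).
  exists (fun x => if x == a then b else f x); split=> [x y xD yD|x xD].
    case: ifPn => xa; case: ifPn => ya.
    + by rewrite (eqP xa) (eqP ya).
    + have /fP /andP[_] : y \in D :\ a by rewrite in_setD1 ya.
      by rewrite in_setD1 => /andP[/eqP h _] e; case: h.
    + have /fP /andP[_] : x \in D :\ a by rewrite in_setD1 xa.
      by rewrite in_setD1 => /andP[/eqP h _] e; case: h.
    + by apply: fi; rewrite in_setD1 ?xa ?ya.
  case: ifPn => [/eqP ->|xa]; first by rewrite ab.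
  have /fP /andP[->] : x \in D :\ a by rewrite in_setD1 xa.
  by rewrite in_setD1 => /andP[].
Qed.

Lemma hall_matching :
  (forall T, #|T| <= #|[set b | [exists a in T, r a b]]|) ->
  exists f : A -> B, injective f /\ forall a, r a (f a).
Proof.
move=> h; have [||f [fi fP]] := @hall_matching_in #|A| [set: A] [set: B].
- by rewrite cardsT.
- move=> T _; apply: leq_trans (h T) _; apply: subset_leq_card.
  by apply/subsetP => b; rewrite !inE.
- exists f; split=> [x y|x]; first by apply: fi; rewrite inE.
  by have /andP[] := fP x (in_setT x).
Qed.
End hall.

(** The matched terms cancel, and each of the [#|J| - #|I|] indices outside the image of [f]
    contributes at most [c]. *)
Lemma norm_sum_injection (R : numDomainType) (V : normedZmodType R)
    (I J : finType) (f : I -> J) (w : J -> V) (c : R) :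
  injective f -> (forall j, `|w j| <= c)%R ->
  (`|\sum_j w j - \sum_i w (f i)| <= c *+ (#|J| - #|I|))%R.
Proof.
move=> f_inj wc; rewrite (bigID [in [set f i | i in I]]) /=.
rewrite big_imset /=; last by move=> x y _ _; exact: f_inj.
rewrite addrAC subrr add0r; apply: le_trans (ler_norm_sum _ _ _) _.
apply: le_trans (ler_sum _ (fun j _ => wc j)) _.
rewrite sumr_const (_ : #|_| = #|J| - #|I|) //.
rewrite -(cardsC [set f i | i in I]) (card_imset _ f_inj) addKn; apply: eq_card => j.
by rewrite !inE.
Qed.

From mathcomp Require Import all_classical all_reals all_analysis.
From mathcomp Require Import ring lra zify.
Import numFieldNormedType.Exports.
Local Open Scope classical_set_scope.
Local Open Scope ring_scope.
Local Open Scope quotient_scope.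

(** * Affine maps *)

Section affine.
Variables (R : realType) (V : lmodType R) (f : V -> V).
Hypothesis faff : affine_map f.

Lemma affine_scale a x : f (a *: x) = a *: (f x - f 0) + f 0.
Proof.
have := faff a x 0; rewrite scaler0 addr0 => ->.
by rewrite scalerBr scalerBl scale1r -[RHS]addrA [f 0 - _]addrC.
Qed.

Lemma affine_add x y : f (x + y) = f x + f y - f 0.
Proof.
have h : 1 - 2^-1 = 2^-1 :> R by field.
have := faff 2^-1 (2 *: x) (2 *: y); rewrite h !scalerA mulVf // !scale1r => ->.
rewrite !affine_scale !scalerDr !scalerA mulVf // !scale1r.
rewrite addrACA -scalerDl (_ : 2^-1 + 2^-1 = 1 :> R); last by field.
by rewrite scale1r -addrA subrK addrAC.
Qed.

Lemma affine_lin a x y : f (a *: x + y) = a *: (f x - f 0) + f y.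
Proof. by rewrite affine_add affine_scale addrAC addrK. Qed.

Lemma affine_sum I (s : seq I) (t : I -> R) (x : I -> V) :
  f (\sum_(i <- s) t i *: x i) = \sum_(i <- s) t i *: (f (x i) - f 0) + f 0.
Proof.
elim: s => [|i s IH]; first by rewrite !big_nil add0r.
by rewrite !big_cons affine_lin IH addrA.
Qed.

Lemma affine_mean I (s : seq I) (t : I -> R) (x : I -> V) :
  \sum_(i <- s) t i = 1 ->
  f (\sum_(i <- s) t i *: x i) = \sum_(i <- s) t i *: f (x i).
Proof.
move=> t1; rewrite affine_sum.
under eq_bigr do rewrite scalerBr.
by rewrite sumrB -scaler_suml t1 scale1r subrK.
Qed.

End affine.

(** * Ultraproducts of Banach spaces *)

Section ultraseq.
Variables (R : realType) (X : nat -> completeNormedModType R).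
Variables (U : set_system nat) (UU : UltraFilter U).
Implicit Types y z : forall n, X n.

Let UF : Filter U := @filter_filter _ _ (@ultra_proper _ _ UU).

Definition unull y := forall e : R, 0 < e -> U [set n | `|y n| <= e].
Definition ubounded y := exists M : R, U [set n | `|y n| <= M].
(** For a bounded sequence this is the limit of the norms along [U], encoded as an infimum so that
    no limit has to be shown to exist. *)
Definition unorm y : R := inf [set r : R | U [set n | `|y n| <= r]].

Lemma ubounded_set y : ubounded y -> has_inf [set r : R | U [set n | `|y n| <= r]].
Proof.
move=> yb; split; first exact: yb.
exists 0 => r /= Ur.
have [n /= nr] := filter_ex Ur.
exact: le_trans nr.
Qed.

Lemma unorm_le y (r : R) : ubounded y -> U [set n | `|y n| <= r] -> unorm y <= r.
Proof. by move=> yb Ur; apply: ge_inf => //; case: (ubounded_set yb). Qed.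

Lemma unorm_ltP y (r : R) : ubounded y -> unorm y < r -> U [set n | `|y n| < r].
Proof.
move=> yb ylt.
have [s /= Us sr] := inf_lt (proj1 (ubounded_set yb)) ylt.
by apply: filterS Us => n /= ns; apply: le_lt_trans sr.
Qed.

(** Unlike the upper bound, this uses the maximality of [U]: otherwise the complement would be large
    and would bound [unorm y] by [r]. *)
Lemma unorm_gtP y (r : R) : ubounded y -> r < unorm y -> U [set n | r < `|y n|].
Proof.
move=> yb ygt.
have [Ur|] := in_ultra_setVsetC [set n | r < `|y n|] UU; first exact.
move=> Ur; have : unorm y <= r.
  apply: unorm_le => //; apply: filterS Ur => n /=.
  by move/negP; rewrite -leNgt.
by rewrite leNgt ygt.
Qed.

Lemma unorm_ge0 y : ubounded y -> 0 <= unorm y.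
Proof.
move=> yb; rewrite leNgt; apply/negP => /(unorm_ltP yb) /filter_ex [n /=].
by rewrite ltNge normr_ge0.
Qed.

Lemma unorm_eq0 y : ubounded y -> unorm y = 0 -> unull y.
Proof.
move=> yb y0 e e0; have ye : unorm y < e by rewrite y0.
by apply: filterS (unorm_ltP yb ye) => n /ltW.
Qed.

Lemma unull_bounded y : unull y -> ubounded y.
Proof. by move=> /(_ 1 ltr01) ?; exists 1. Qed.

Lemma uboundedD y z : ubounded y -> ubounded z -> ubounded (fun n => y n + z n).
Proof.
move=> [M UM] [N UN]; exists (M + N); apply: filterS2 UM UN => n /= yM zN.
by apply: le_trans (ler_normD _ _) (lerD yM zN).
Qed.

Lemma uboundedZ a y : ubounded y -> ubounded (fun n => a *: y n).
Proof.
move=> [M UM]; exists (`|a| * M); apply: filterS UM => n /= yM.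
by rewrite normrZ ler_wpM2l.
Qed.

Lemma unorm_near y z : ubounded z -> unull (fun n => y n - z n) ->
  unorm y = unorm z.
Proof.
move=> zb yz.
have yb : ubounded y.
  have [M UM] := uboundedD zb (unull_bounded yz); exists M.
  by apply: filterS UM => n /=; rewrite addrC subrK.
have aux y' z' : ubounded y' -> ubounded z' -> unull (fun n => y' n - z' n) ->
    unorm y' <= unorm z'.
  move=> y'b z'b yz'; apply/ler_addgt0Pr => e e0.
  have e2 : 0 < e / 2 by rewrite divr_gt0.
  apply: unorm_le => //.
  have z'lt : unorm z' < unorm z' + e / 2 by rewrite ltrDl.
  apply: filterS2 (unorm_ltP z'b z'lt) (yz' _ e2) => n /= h1 h2.
  rewrite -(subrK (z' n) (y' n)); apply: le_trans (ler_normD _ _) _; lra.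
apply/le_anti/andP; split; first exact: aux.
apply: aux => // e e0; apply: filterS (yz _ e0) => n /=.
by rewrite distrC.
Qed.

Lemma unullN y : unull y -> unull (fun n => - y n).
Proof. by move=> y0 e e0; apply: filterS (y0 _ e0) => n /=; rewrite normrN. Qed.

Lemma unullD y z : unull y -> unull z -> unull (fun n => y n + z n).
Proof.
move=> y0 z0 e e0; have e2 : 0 < e / 2 by rewrite divr_gt0.
apply: filterS2 (y0 _ e2) (z0 _ e2) => n /= h1 h2.
apply: le_trans (ler_normD _ _) _; lra.
Qed.

Lemma unullZ a y : unull y -> unull (fun n => a *: y n).
Proof.
move=> y0 e e0.
have p : 0 < `|a| + 1 by apply: ltr_wpDl.
apply: filterS (y0 _ (divr_gt0 e0 p)) => n /= h.
rewrite normrZ; apply: le_trans (_ : (`|a| + 1) * `|y n| <= e).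
  by rewrite ler_wpM2r// lerDl.
by rewrite mulrC -ler_pdivlMr.
Qed.

Lemma unull0 : unull (fun=> 0).
Proof. by move=> e e0; apply: filterS (@filterT _ _ UF) => n _ /=; rewrite normr0 ltW. Qed.

Lemma unull_ext y z : (forall n, y n = z n) -> unull y -> unull z.
Proof. by move=> yz; congr unull; apply: functional_extensionality_dep. Qed.

Lemma unull_refl y : unull (fun n => y n - y n).
Proof. by apply: unull_ext unull0 => n; rewrite subrr. Qed.

End ultraseq.

(** An ultraproduct cut down to a linear space [ud_seq] of bounded sequences, because the limit
    action will be continuous only on a part of the full ultraproduct. Closedness of [ud_seq] in the
    seminorm along the filter makes the quotient complete. *)
Record ultradata (R : realType) := UltraData {
  ud_space : nat -> completeNormedModType R;
  ud_filter : set_system nat;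
  ud_ultra : UltraFilter ud_filter;
  ud_free : forall k, ud_filter [set n | (k <= n)%N];
  ud_seq : set (forall n, ud_space n);
  ud_bounded : forall y, ud_seq y -> ubounded ud_filter y;
  ud_0 : ud_seq (fun=> 0);
  ud_lin : forall a y z, ud_seq y -> ud_seq z -> ud_seq (fun n => a *: y n + z n);
  ud_closed : forall y, (forall e, 0 < e ->
    exists2 z, ud_seq z & ud_filter [set n | `|y n - z n| <= e]) -> ud_seq y
}.

Section ultraspace.
Variables (R : realType) (d : ultradata R).
Local Notation X := (ud_space d).
Local Notation U := (ud_filter d).
Local Notation L := (@ud_seq R d).
Implicit Types y z : forall n, X n.

Let UU : UltraFilter U := ud_ultra d.
Let UF : Filter U := @filter_filter _ _ (@ultra_proper _ _ UU).

#[local] Existing Instance UF.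

(* Sequences outside [ud_seq] are identified with 0, so that the quotient can be
   taken on the type of all sequences. *)
Definition useq y : forall n, X n := if `[< L y >] then y else (fun=> 0).
Lemma useqL y : L (useq y).
Proof. by rewrite /useq; case: asboolP => // _; exact: ud_0. Qed.
Lemma useqE y : L y -> useq y = y.
Proof. by rewrite /useq; case: asboolP. Qed.

Definition uequiv y z := `[< unull U (fun n => useq y n - useq z n) >].

Lemma uequiv_refl : reflexive uequiv.
Proof. by move=> y; apply/asboolP; exact: (unull_refl UU). Qed.
Lemma uequiv_sym : symmetric uequiv.
Proof.
move=> y z; apply/asboolP/asboolP => /(unullN UU); apply: unull_ext => n;
  by rewrite opprB.
Qed.
Lemma uequiv_trans : transitive uequiv.
Proof.
move=> y z t /asboolP h1 /asboolP h2; apply/asboolP.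
by apply: unull_ext (unullD UU h1 h2) => n; rewrite addrA subrK.
Qed.
Canonical uequiv_equiv := EquivRel uequiv uequiv_refl uequiv_sym uequiv_trans.

Definition ultraspace := {eq_quot uequiv}%qT.
HB.instance Definition _ := Choice.on ultraspace.
HB.instance Definition _ := EqQuotient.on ultraspace.

Definition upi y : ultraspace := \pi y.
Definition urep (q : ultraspace) := useq (repr q).

Lemma urepL q : L (urep q). Proof. exact: useqL. Qed.
Lemma upiP y z : L y -> L z -> unull U (fun n => y n - z n) -> upi y = upi z.
Proof.
by move=> Ly Lz yz; apply/eqquotP/asboolP; rewrite !useqE.
Qed.
Lemma upi_eq y z : L y -> L z -> upi y = upi z -> unull U (fun n => y n - z n).
Proof. by move=> Ly Lz /eqquotP/asboolP; rewrite !useqE. Qed.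
Lemma urepK q : upi (urep q) = q.
Proof.
rewrite -[RHS]reprK; apply/eqquotP/asboolP.
by rewrite (useqE (useqL _)); exact: (unull_refl UU).
Qed.
Lemma urep_upi y : L y -> unull U (fun n => urep (upi y) n - y n).
Proof. by move=> Ly; apply: upi_eq (urepL _) Ly _; rewrite urepK. Qed.

Lemma ud_D y z : L y -> L z -> L (fun n => y n + z n).
Proof.
move=> Ly Lz; rewrite (_ : (fun n => _) = (fun n => 1 *: y n + z n)).
  exact: ud_lin.
by apply: functional_extensionality_dep => n; rewrite scale1r.
Qed.
Lemma ud_Z a y : L y -> L (fun n => a *: y n).
Proof.
move=> Ly; rewrite (_ : (fun n => _) = (fun n => a *: y n + 0)).
  by apply: ud_lin => //; exact: ud_0.
by apply: functional_extensionality_dep => n; rewrite addr0.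
Qed.
Lemma ud_N y : L y -> L (fun n => - y n).
Proof.
move=> Ly; rewrite (_ : (fun n => _) = (fun n => -1 *: y n)).
  exact: ud_Z.
by apply: functional_extensionality_dep => n; rewrite scaleN1r.
Qed.

Definition uadd (p q : ultraspace) := upi (fun n => urep p n + urep q n).
Definition uopp (p : ultraspace) := upi (fun n => - urep p n).
Definition uscale a (p : ultraspace) := upi (fun n => a *: urep p n).

Lemma upiD y z : L y -> L z -> uadd (upi y) (upi z) = upi (fun n => y n + z n).
Proof.
move=> Ly Lz; apply: upiP; [|exact: ud_D|].
  by apply: ud_D; exact: urepL.
apply: unull_ext (unullD UU (urep_upi Ly) (urep_upi Lz)) => n.
by rewrite opprD addrACA.
Qed.
Lemma upiN y : L y -> uopp (upi y) = upi (fun n => - y n).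
Proof.
move=> Ly; apply: upiP; [|exact: ud_N|].
  by apply: ud_N; exact: urepL.
by apply: unull_ext (unullN UU (urep_upi Ly)) => n; rewrite opprD.
Qed.
Lemma upiZ a y : L y -> uscale a (upi y) = upi (fun n => a *: y n).
Proof.
move=> Ly; apply: upiP; [|exact: ud_Z|].
  by apply: ud_Z; exact: urepL.
by apply: unull_ext (unullZ UU a (urep_upi Ly)) => n; rewrite scalerBr.
Qed.

Lemma upi_ext y z : (forall n, y n = z n) -> upi y = upi z.
Proof. by move=> yz; congr upi; apply: functional_extensionality_dep. Qed.

Lemma ultra_ind (P : ultraspace -> Prop) : (forall y, L y -> P (upi y)) -> forall q, P q.
Proof. by move=> h q; rewrite -(urepK q); apply: h; exact: urepL. Qed.

Let z0 : ultraspace := upi (fun=> 0).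

Lemma uaddA : associative uadd.
Proof.
elim/ultra_ind => y Ly; elim/ultra_ind => z Lz; elim/ultra_ind => t Lt.
by rewrite !upiD //; try exact: ud_D; apply: upi_ext => n; rewrite addrA.
Qed.
Lemma uaddC : commutative uadd.
Proof.
elim/ultra_ind => y Ly; elim/ultra_ind => z Lz.
by rewrite !upiD //; apply: upi_ext => n; rewrite addrC.
Qed.
Lemma uadd0 : left_id z0 uadd.
Proof.
elim/ultra_ind => y Ly; rewrite !upiD //; last exact: ud_0.
by apply: upi_ext => n; rewrite add0r.
Qed.
Lemma uaddN : left_inverse z0 uopp uadd.
Proof.
elim/ultra_ind => y Ly; rewrite upiN // !upiD //; last exact: ud_N.
by apply: upi_ext => n; rewrite addNr.
Qed.
HB.instance Definition _ := GRing.isZmodule.Build ultraspace uaddA uaddC uadd0 uaddN.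

Lemma uscaleA a b v : uscale a (uscale b v) = uscale (a * b) v.
Proof.
elim/ultra_ind: v => y Ly; rewrite !upiZ //; last exact: ud_Z.
by apply: upi_ext => n; rewrite scalerA.
Qed.
Lemma uscale1 : left_id 1 uscale.
Proof. by elim/ultra_ind => y Ly; rewrite upiZ//; apply: upi_ext => n; rewrite scale1r. Qed.
Lemma uscaleDr : right_distributive uscale +%R.
Proof.
move=> a; elim/ultra_ind => y Ly; elim/ultra_ind => z Lz.
rewrite -[LHS]/(uscale a (uadd (upi y) (upi z))).
rewrite -[RHS]/(uadd (uscale a (upi y)) (uscale a (upi z))).
rewrite (upiZ a Ly) (upiZ a Lz) (upiD Ly Lz) (upiZ a (ud_D Ly Lz)).
rewrite (upiD (ud_Z a Ly) (ud_Z a Lz)).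
by apply: upi_ext => n; rewrite scalerDr.
Qed.
Lemma uscaleDl v : {morph uscale^~ v : a b / a + b}.
Proof.
move=> a b; elim/ultra_ind: v => y Ly; rewrite /= !upiZ //.
rewrite [RHS]upiD //; try exact: ud_Z.
by apply: upi_ext => n; rewrite scalerDl.
Qed.
HB.instance Definition _ := GRing.Zmodule_isLmodule.Build R ultraspace
  uscaleA uscale1 uscaleDr uscaleDl.

Definition unrm (q : ultraspace) : R := unorm U (urep q).

Lemma unrmE y : L y -> unrm (upi y) = unorm U y.
Proof.
by move=> Ly; apply: (unorm_near UU (ud_bounded Ly) (urep_upi Ly)).
Qed.

Lemma addE y z : L y -> L z -> upi y + upi z = upi (fun n => y n + z n).
Proof. exact: upiD. Qed.
Lemma scaleE a y : L y -> a *: upi y = upi (fun n => a *: y n).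
Proof. exact: upiZ. Qed.
Lemma oppE y : L y -> - upi y = upi (fun n => - y n).
Proof. exact: upiN. Qed.
Lemma zeroE : 0 = upi (fun=> 0).
Proof. by []. Qed.

Lemma unrmD p q : unrm (p + q) <= unrm p + unrm q.
Proof.
elim/ultra_ind: p => y Ly; elim/ultra_ind: q => z Lz.
have Lyz := ud_D Ly Lz.
rewrite addE // !unrmE //; apply/ler_addgt0Pr => e e0.
have e2 : 0 < e / 2 by rewrite divr_gt0.
have ylt : unorm U y < unorm U y + e / 2 by rewrite ltrDl.
have zlt : unorm U z < unorm U z + e / 2 by rewrite ltrDl.
apply: unorm_le => //; first exact: ud_bounded.
apply: filterS2 (unorm_ltP UU (ud_bounded Ly) ylt) (unorm_ltP UU (ud_bounded Lz) zlt).
move=> n /= h1 h2; apply: le_trans (ler_normD _ _) _; lra.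
Qed.

Lemma unrmZ a p : unrm (a *: p) = `|a| * unrm p.
Proof.
have aux b q : unrm (b *: q) <= `|b| * unrm q.
  elim/ultra_ind: q => y Ly; have Lby := ud_Z b Ly.
  rewrite scaleE // !unrmE //; apply/ler_addgt0Pr => e e0.
  have p0 : 0 < `|b| + 1 by apply: ltr_wpDl.
  have ylt : unorm U y < unorm U y + e / (`|b| + 1) by rewrite ltrDl divr_gt0.
  apply: unorm_le => //; first exact: ud_bounded.
  apply: filterS (unorm_ltP UU (ud_bounded Ly) ylt) => n /= h.
  rewrite normrZ; apply: le_trans (ler_wpM2l (normr_ge0 b) (ltW h)) _.
  rewrite mulrDr lerD2l mulrCA ger_pMr // ler_pdivrMr // mul1r lerDl //.
have [->|a0] := eqVneq a 0.
  rewrite scale0r normr0 mul0r zeroE unrmE; last exact: ud_0.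
  apply/eqP; rewrite eq_le; apply/andP; split.
    apply: unorm_le => //; first exact: ud_bounded (ud_0 d).
    by apply: filterS (@filterT _ _ UF) => n _ /=; rewrite normr0.
  by apply: unorm_ge0 => //; exact: ud_bounded (ud_0 d).
apply/le_anti/andP; split; first exact: aux.
have := aux a^-1 (a *: p); rewrite scalerA mulVf // scale1r normfV.
by rewrite ler_pdivlMl // normr_gt0.
Qed.

Lemma unrm0_eq0 p : unrm p = 0 -> p = 0.
Proof.
elim/ultra_ind: p => y Ly; rewrite unrmE // => y0.
rewrite zeroE; apply: upiP => //; first exact: ud_0.
by apply: unull_ext (unorm_eq0 UU (ud_bounded Ly) y0) => n; rewrite subr0.
Qed.

HB.instance Definition _ := Lmodule_isNormed.Build R ultraspace unrmD unrmZ unrm0_eq0.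

Lemma ultranormE y : L y -> `|upi y| = unorm U y.
Proof. exact: unrmE. Qed.

End ultraspace.

(** * Completeness of the ultraproduct *)

Lemma half_exp_lt (R : realType) (e : R) : 0 < e -> exists k, 2^-1 ^+ k < e.
Proof.
move=> e0.
have [n ne] := ltr_add_invr (y := 0) (x := e) e0.
exists n.+1; apply: lt_trans (_ : n.+1%:R^-1 < e); last by rewrite add0r in ne.
rewrite exprVn ltf_pV2 ?posrE ?exprn_gt0 // -natrX ltr_nat.
exact: ltn_expl.
Qed.

(** A Cauchy filter contains balls of radius 2^-(k+2) around some [x k]. Consecutive balls meet, so
    the centres move by at most 2^-k, and their limit is a limit of the filter. *)
Lemma complete_of_geometric (R : realType) (V : normedModType R) :
  (forall x : nat -> V, (forall k, `|x k.+1 - x k| <= 2^-1 ^+ k) ->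
     exists l, forall k, `|x k - l| <= 4 * 2^-1 ^+ k) ->
  forall F : set_system V, ProperFilter F -> cauchy F -> cvg F.
Proof.
move=> Vc F FF Fc.
have p k : 0 < (2^-1 : R) ^+ k by rewrite exprn_gt0.
have /choice [x Fx] : forall k, exists x : V, F (ball x (2^-1 ^+ k.+2 : R)).
  by move=> k; apply: ((cauchyP F).1 Fc).
have [k|l xl] := Vc x.
  have [y [y1 y2]] := filter_ex (filterI (Fx k) (Fx k.+1)).
  move: y1 y2; rewrite -!ball_normE /= => y1 y2.
  have -> : x k.+1 - x k = (x k.+1 - y) - (x k - y) by rewrite opprB addrA subrK.
  apply: le_trans (ler_normB _ _) _.
  move: y1 y2; rewrite !exprS; have := p k; lra.
apply/cvg_ex; exists l; apply/cvgrPdist_le => e e0.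
have [k ke] : exists k, (2^-1 : R) ^+ k < e / 5 by apply: half_exp_lt; rewrite divr_gt0.
apply: filterS (Fx k) => y; rewrite -ball_normE /= => y1.
have -> : l - y = (x k - y) - (x k - l) by rewrite opprB [RHS]addrC addrA subrK.
apply: le_trans (ler_normB _ _) _.
have := xl k; move: y1 ke; rewrite !exprS; have := p k; lra.
Qed.

Lemma geometric_sum_le (R : realType) (V : normedModType R) (x : nat -> V) k m : (k <= m)%N ->
  (forall j, (k <= j < m)%N -> `|x j.+1 - x j| <= 2^-1 ^+ j *+ 2) ->
  `|x k - x m| <= 2^-1 ^+ k *+ 4.
Proof.
(* The increments 2 * 2^-j add up to exactly 4 * (2^-k - 2^-m), and this sharper bound is the one
   that passes through the induction. *)
move=> km h; suff : `|x k - x m| <= (2^-1 ^+ k - 2^-1 ^+ m) *+ 4.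
  have p : 0 < (2^-1 : R) ^+ m by rewrite exprn_gt0.
  by move=> h'; apply: le_trans h' _; lra.
elim: m km h => [|m IH].
  by rewrite leqn0 => /eqP -> _; rewrite !subrr normr0; lra.
rewrite leq_eqVlt => /orP[/eqP <- _|].
  by rewrite !subrr normr0; lra.
rewrite ltnS => km h.
have -> : x k - x m.+1 = (x k - x m) - (x m.+1 - x m) by rewrite opprB addrA subrK.
apply: le_trans (ler_normB _ _) _.
have : `|x m.+1 - x m| <= 2^-1 ^+ m *+ 2 by apply: h; rewrite km ltnSn.
have : `|x k - x m| <= (2^-1 ^+ k - 2^-1 ^+ m) *+ 4.
  by apply: IH => // j /andP[kj jm]; apply: h; rewrite kj ltnS ltnW.
by rewrite exprS; lra.
Qed.

Section ultracomplete.
Variables (R : realType) (d : ultradata R).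
Local Notation X := (ud_space d).
Local Notation U := (ud_filter d).
Local Notation L := (@ud_seq R d).

Let UU : UltraFilter U := ud_ultra d.
Let UF : Filter U := @filter_filter _ _ (@ultra_proper _ _ UU).
#[local] Existing Instance UF.

(** Diagonal argument: coordinate [n] of the limit is taken from the representative [y (K n)], where
    [K n] is the largest index up to which the representatives satisfy their estimates at [n]. *)
Lemma ultra_geometric (x : nat -> ultraspace d) :
  (forall k, `|x k.+1 - x k| <= 2^-1 ^+ k) ->
  exists l, forall k, `|x k - l| <= 4 * 2^-1 ^+ k.
Proof.
move=> xk; pose y k := urep (x k).
have yL k : L (y k) by exact: urepL.
have yx k : x k = upi (y k) by rewrite urepK.
have p k : 0 < (2^-1 : R) ^+ k by rewrite exprn_gt0.
(* The factor 2 makes the bound on the norm of the class strict, hence valid for the coordinates on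
   a set of [U]. *)
pose good k n := `|y k.+1 n - y k n| <= 2^-1 ^+ k *+ 2.
have Ugood k : U [set n | good k n].
  have := xk k; rewrite !yx oppE // addE //; last exact: ud_N.
  have Lk : L (fun n => y k.+1 n - y k n) by apply: ud_D => //; exact: ud_N.
  rewrite ultranormE // => h.
  have h2 : unorm U (fun n => y k.+1 n - y k n) < 2^-1 ^+ k *+ 2.
    by apply: le_lt_trans h _; have := p k; lra.
  by apply: filterS (unorm_ltP UU (ud_bounded Lk) h2) => n /ltW.
pose ok k n := all (fun j => `[< good j n >]) (iota 0 k).
have Uok k : U [set n | ok k n].
  elim: k => [|k IH]; first by apply: filterS (@filterT _ _ UF) => n _.
  apply: filterS2 IH (Ugood k) => n /= h1 h2.
  by rewrite /ok -addn1 iotaD all_cat -/(ok k n) h1 /= add0n andbT; apply/asboolP.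
have okP k n : ok k n -> forall j, (j < k)%N -> good j n.
  by move=> /allP h j jk; apply/asboolP/h; rewrite mem_iota.
have ex n : exists k, ok k n && (k <= n)%N by exists 0.
have bd n k : ok k n && (k <= n)%N -> (k <= n)%N by case/andP.
(* The cap [k <= n] makes the maximum exist. Since [U] contains every final segment, [K n] is still
   at least any given [k] on a set of [U]. *)
pose K n := ex_maxn (ex n) (@bd n).
pose z n := y (K n) n.
have zy k : U [set n | `|y k n - z n| <= 2^-1 ^+ k *+ 4].
  apply: filterS2 (Uok k) (ud_free d k) => n /= okk kn.
  have kK : (k <= K n)%N.
    by rewrite /K; case: ex_maxnP => m _ /(_ k); rewrite okk kn; exact.
  apply: (geometric_sum_le (x := fun j => y j n) kK) => j /andP[_ jK].
  rewrite /K in jK; move: jK; case: ex_maxnP => m /andP[okm _] _ jm.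
  exact: okP okm _ jm.
have zL : L z.
  apply: ud_closed => e e0; have [k ke] := half_exp_lt (divr_gt0 e0 (ltr0Sn R 3)).
  exists (y k) => //; apply: filterS (zy k) => n /=; rewrite distrC => h.
  by apply: le_trans h _; lra.
exists (upi z) => k; rewrite yx oppE // addE //; last exact: ud_N.
have Lk : L (fun n => y k n - z n) by apply: ud_D => //; exact: ud_N.
rewrite ultranormE //; apply: unorm_le => //; first exact: ud_bounded.
by apply: filterS (zy k) => n /=; rewrite mulr_natl.
Qed.

Lemma ultra_complete (F : set_system (ultraspace d)) :
  ProperFilter F -> cauchy F -> cvg F.
Proof.
by apply: complete_of_geometric; exact: ultra_geometric.
Qed.
HB.instance Definition _ := Uniform_isComplete.Build (ultraspace d) ultra_complete.
End ultracomplete.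

(** * Finite representability of the ultraproduct *)

Definition lincomb (R : realType) (V : lmodType R) k (v : 'I_k -> V) (a : 'I_k -> R) :=
  \sum_(i < k) a i *: v i.

Definition lspan (R : realType) (V : lmodType R) k (v : 'I_k -> V) : set V :=
  [set x | exists a, x = lincomb v a].

Definition independent (R : realType) (V : lmodType R) k (v : 'I_k -> V) :=
  forall a, lincomb v a = 0 -> forall i, a i = 0.

Lemma lincombD (R : realType) (V : lmodType R) k (v : 'I_k -> V) (c : R) a b :
  lincomb v (fun i => c * a i + b i) = c *: lincomb v a + lincomb v b.
Proof.
rewrite /lincomb scaler_sumr -big_split /=; apply: eq_bigr => i _.
by rewrite scalerDl scalerA.
Qed.

Lemma lincombZ (R : realType) (V : lmodType R) k (v : 'I_k -> V) (c : R) a :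
  lincomb v (fun i => c * a i) = c *: lincomb v a.
Proof.
by rewrite /lincomb scaler_sumr; apply: eq_bigr => i _; rewrite scalerA.
Qed.

Lemma lincombB (R : realType) (V : lmodType R) k (v : 'I_k -> V) a b :
  lincomb v (fun i => a i - b i) = lincomb v a - lincomb v b.
Proof.
by rewrite /lincomb -sumrB; apply: eq_bigr => i _; rewrite scalerBl.
Qed.

Lemma lspan_submod (R : realType) (V : lmodType R) k (v : 'I_k -> V) :
  submod_closed [in lspan v].
Proof.
split; first by rewrite inE; exists (fun=> 0); rewrite /lincomb big1// => i _; rewrite scale0r.
move=> c x y; rewrite !inE => -[a ->] [b ->].
by exists (fun i => c * a i + b i); rewrite lincombD.
Qed.

(** A generating family of minimal size is independent, since a nontrivial relation expresses one
    vector by the others. *)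
Lemma finite_dimensional_independent (R : realType) (V : lmodType R) (Y : set V) :
  finite_dimensional Y -> exists k (v : 'I_k -> V), Y = lspan v /\ independent v.
Proof.
move=> Yf; pose P k := `[< exists v : 'I_k -> V, Y = lspan v >].
have [k [v Yv]] : exists k, exists v : 'I_k -> V, Y = lspan v by exact: Yf.
have exP : exists k, P k by exists k; apply/asboolP; exists v.
case: (ex_minnP exP) => {k v Yv exP} m /asboolP [v Yv] mmin.
exists m, v; split=> // a a0 j; apply/eqP/negP => /negP aj.
case: m => [|m] in v Yv mmin a a0 j aj *; first by case: j aj.
suff : P m by move=> /mmin; rewrite ltnn.
apply/asboolP; exists (fun i => v (lift j i)).
have vj : v j = lincomb (fun i => v (lift j i)) (fun i => - (a j)^-1 * a (lift j i)).
  rewrite lincombZ; move: a0; rewrite /lincomb (bigD1_ord j) //= => /eqP.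
  rewrite addr_eq0 => /eqP h.
  by rewrite scaleNr -scalerN -h scalerA mulVf// scale1r.
rewrite Yv; apply/seteqP; split=> x [b ->].
  exists (fun i => b j * (- (a j)^-1 * a (lift j i)) + b (lift j i)).
  by rewrite lincombD -vj /lincomb (bigD1_ord j).
exists (fun i => if unlift j i is Some i' then b i' else 0).
rewrite /lincomb [RHS](bigD1_ord j) //= unlift_none scale0r add0r.
by apply: eq_bigr => i _; rewrite liftK.
Qed.

(** The map between the spans that preserves coefficients has norm at most [1 + e], and its inverse
    has norm at most [(1 - e)^-1]. *)
Lemma Banach_Mazur_lspan (R : realType) (V W : normedModType R) k
    (v : 'I_k -> V) (w : 'I_k -> W) (e : R) : 0 <= e < 1 -> independent v ->
  (forall a, `| `|lincomb w a| - `|lincomb v a| | <= e * `|lincomb v a|) ->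
  (Banach_Mazur (lspan v) (lspan w) <= ((1 + e) / (1 - e))%:E)%E.
Proof.
move=> /andP[e0 e1] vi vw.
have vinj a b : lincomb v a = lincomb v b -> a = b.
  move=> ab; apply/funext => i; apply/eqP; rewrite -subr_eq0; apply/eqP.
  by apply: (vi (fun i => a i - b i)); rewrite lincombB ab subrr.
have up a : `|lincomb w a| <= (1 + e) * `|lincomb v a|.
  by have := vw a; rewrite ler_norml; lra.
have dn a : (1 - e) * `|lincomb v a| <= `|lincomb w a|.
  by have := vw a; rewrite ler_norml; lra.
have winj a b : lincomb w a = lincomb w b -> a = b.
  move=> ab; apply: vinj; apply/eqP; rewrite -subr_eq0 -lincombB -normr_eq0.
  have := dn (fun i => a i - b i); rewrite [lincomb w _]lincombB ab subrr normr0.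
  by rewrite eq_le normr_ge0 andbT pmulr_rle0 // subr_gt0.
(* [get] reads off the coefficients, unique by independence; the values off the spans are
   irrelevant. *)
pose T x := lincomb w (get [set a | x = lincomb v a]).
pose T' z := lincomb v (get [set a | z = lincomb w a]).
have TE a : T (lincomb v a) = lincomb w a.
  rewrite /T; congr lincomb; case: xgetP => [b _ /vinj -> //|/(_ a) []] //.
have T'E a : T' (lincomb w a) = lincomb v a.
  rewrite /T'; congr lincomb; case: xgetP => [b _ /winj -> //|/(_ a) []] //.
have lc0 (V' : normedModType R) (v' : 'I_k -> V') : lincomb v' (fun=> 0) = 0.
  by rewrite /lincomb big1 // => i _; rewrite scale0r.
have p : 0 < 1 - e by rewrite subr_gt0.
(* The lower bounds are recorded because the product of extended reals is monotone only for
   nonnegative factors. *)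
have opT : (0 <= opnorm (lspan v) T <= (1 + e)%:E)%E.
  apply/andP; split.
    apply: ereal_sup_ubound; exists 0; first split=> /=.
    - by exists (fun=> 0); rewrite lc0.
    - by rewrite normr0.
    - by rewrite -(lc0 V v) TE lc0 normr0.
  apply: ge_ereal_sup => _ [_ [[a ->] /= ha] <-]; rewrite TE lee_fin.
  by apply: le_trans (up a) _; rewrite ger_pMr//; lra.
have opT' : (0 <= opnorm (lspan w) T' <= ((1 - e)^-1)%:E)%E.
  apply/andP; split.
    apply: ereal_sup_ubound; exists 0; first split=> /=.
    - by exists (fun=> 0); rewrite lc0.
    - by rewrite normr0.
    - by rewrite -(lc0 W w) T'E lc0 normr0.
  apply: ge_ereal_sup => _ [_ [[a ->] /= ha] <-]; rewrite T'E lee_fin.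
  by rewrite -[leRHS]mul1r ler_pdivlMr // mulrC; apply: le_trans (dn a) _.
apply: le_trans (_ : (opnorm (lspan v) T * opnorm (lspan w) T' <= _)%E); last first.
  move: opT opT' => /andP[h1 h2] /andP[h3 h4].
  by rewrite EFinM; exact: lee_pmul.
apply: ereal_inf_lbound; exists T, T'; split=> //.
- move=> c x y; rewrite !inE => -[a ->] [b ->].
  by rewrite -lincombD !TE lincombD.
- split.
  + by move=> _ [a ->]; rewrite TE; exists a.
  + move=> x y; rewrite !inE => -[a ->] [b ->]; rewrite !TE => /winj ->//.
  + by move=> _ [a ->]; exists (lincomb v a); [exists a|rewrite TE].
- by move=> x; rewrite inE => -[a ->]; rewrite TE T'E.
Qed.

Lemma lincomb_norm_le (R : realType) (V : normedModType R) k (v : 'I_k -> V) a c :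
  (forall i, `|a i| <= c) -> `|lincomb v a| <= c * \sum_i `|v i|.
Proof.
move=> ac; apply: le_trans (ler_norm_sum _ _ _) _; rewrite mulr_sumr.
by apply: ler_sum => i _; rewrite normrZ ler_wpM2r.
Qed.

Section ultrafr.
Variables (R : realType) (d : ultradata R).
Local Notation X := (ud_space d).
Local Notation U := (ud_filter d).
Local Notation L := (@ud_seq R d).

Let UU : UltraFilter U := ud_ultra d.
Let UP : ProperFilter U := @ultra_proper _ _ UU.
Let UF : Filter U := @filter_filter _ _ UP.
#[local] Existing Instance UF.
#[local] Existing Instance UP.

Lemma ultra_real_lim (a : nat -> R) : (forall n, `|a n| <= 1) ->
  exists l, forall e, 0 < e -> U [set n | `|a n - l| <= e].
Proof.
move=> a1; have := @segment_compact R (-1) 1; rewrite compact_ultra.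
move=> /(_ (a @ U)) [||l [_ /= al]].
- split; first exact: fmap_proper_filter.
  move=> G GP aG; apply/seteqP; split=> // A GA.
  have [//|h] := in_ultra_setVsetC (a @^-1` A) UU.
  have /aG GA' : (a @ U) (~` A) by [].
  by have [x []] := filter_ex (filterI GA GA').
- apply: filterS (@filterT _ _ UF) => n _ /=.
  by rewrite in_itv /= -ler_norml.
- exists l => e e0; have /cvgrPdist_le /(_ e e0) := al.
  by apply: filterS => n /=; rewrite distrC.
Qed.

Lemma upi_lincomb k (y : 'I_k -> forall n, X n) a : (forall i, L (y i)) ->
  L (fun n => lincomb (fun i => y i n) a) /\
  upi (fun n => lincomb (fun i => y i n) a) = lincomb (fun i => upi (y i)) a :> ultraspace d.
Proof.
move=> yL; rewrite /lincomb; elim: (index_enum _) => [|i s [IL IH]].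
  rewrite (_ : (fun n => _) = (fun n => 0)) ?big_nil; first by split=> //; exact: ud_0.
  by apply: functional_extensionality_dep => n; rewrite big_nil.
pose f n := a i *: y i n; pose g n := \sum_(j <- s) a j *: y j n.
rewrite (_ : (fun n => _) = (fun n => f n + g n)); last first.
  by apply: functional_extensionality_dep => n; rewrite big_cons.
rewrite big_cons -IH scaleE // addE //; last exact: ud_Z.
by split=> //; apply: ud_D => //; exact: ud_Z.
Qed.

(** The same set of [n] must serve all coefficients. If it were not in [U], bad coefficients of l1
    norm 1 would have a limit [l] along [U], with nonzero combination by independence, and the
    estimate at [l] alone excludes bad coefficients close to [l]. *)
Lemma ultra_lincomb_norm k (y : 'I_k -> forall n, X n) (e : R) :
  (forall i, L (y i)) -> 0 < e -> independent (fun i => upi (y i) : ultraspace d) ->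
  U [set n | forall a, `| `|lincomb (fun i => y i n) a| -
     `|lincomb (fun i => upi (y i) : ultraspace d) a| | <=
     e * `|lincomb (fun i => upi (y i) : ultraspace d) a|].
Proof.
move=> yL e0 vi; set v := fun i => upi (y i).
have [//|Ubad] := in_ultra_setVsetC [set n | forall a, `| `|lincomb (fun i => y i n) a| -
     `|lincomb v a| | <= e * `|lincomb v a|] UU; exfalso.
pose bad n a := e * `|lincomb v a| < `| `|lincomb (fun i => y i n) a| - `|lincomb v a| |.
(* Scaling a bad vector keeps it bad, so it can be given l1 norm 1. Where there is none, 0 is a
   placeholder that keeps the family bounded. *)
have bex n : exists a, (forall i, `|a i| <= 1) /\
   ((exists b, bad n b) -> \sum_i `|a i| = 1 /\ bad n a).
  have [[b nb]|nb] := pselect (exists b, bad n b); last first.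
    by exists (fun=> 0); split=> // i; rewrite normr0.
  pose s := \sum_i `|b i|.
  have s0 : 0 < s.
    rewrite lt_neqAle sumr_ge0 // andbT eq_sym; apply/eqP => s0.
    have b0 i : b i = 0.
      apply/normr0_eq0/eqP; move/eqP: s0; rewrite psumr_eq0 // => /allP /(_ i).
      by rewrite mem_index_enum => /(_ isT).
    move: nb; rewrite /bad /lincomb !big1 ?normr0 ?subrr ?normr0 ?mulr0 ?ltxx // => i _.
      by rewrite b0 scale0r.
    by rewrite b0 scale0r.
  exists (fun i => s^-1 * b i); split=> [i|_].
    rewrite normrM normfV (gtr0_norm s0) ler_pdivrMl // mulr1 /s (bigD1 i) //=.
    by rewrite lerDl sumr_ge0.
  split.
    rewrite -(mulVf (lt0r_neq0 s0)) /s mulr_sumr; apply: eq_bigr => i _.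
    by rewrite normrM normfV (gtr0_norm s0).
  rewrite /bad !lincombZ !normrZ -mulrBr normrM mulrCA normr_id ltr_pM2l //.
  by rewrite normr_gt0 invr_eq0 gt_eqF.
have {bex} [a a1] := choice bex.
have Ua : U [set n | \sum_i `|a n i| = 1 /\ bad n (a n)].
  apply: filterS Ubad => n /= /existsNP [b /negP]; rewrite -ltNge => nb.
  by case: (a1 n) => _; apply; exists b.
have /choice [l al] : forall i, exists l, forall e, 0 < e -> U [set n | `|a n i - l| <= e].
  by move=> i; apply: ultra_real_lim => n; case: (a1 n).
have {}al e' : 0 < e' -> U [set n | forall i, `|a n i - l i| <= e'].
  by move=> e'0; apply: filter_forall => i; apply: al.
have l1 : \sum_i `|l i| = 1.
  apply/eqP; rewrite -subr_eq0 -normr_le0 leNgt; apply/negP => h.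
  set t := `|_| in h.
  have k0 : 0 < (k%:R + 1 : R) by rewrite ltr_wpDl.
  have [n /= [[n1 _] n2]] := filter_ex (filterI Ua (al _ (divr_gt0 h k0))).
  have : t <= k%:R * (t / (k%:R + 1)).
    rewrite {1}/t -[X in _ - X]n1 -sumrB; apply: le_trans (ler_norm_sum _ _ _) _.
    apply: le_trans (_ : \sum_(i < k) (t / (k%:R + 1)) <= _); last first.
      by rewrite sumr_const card_ord mulr_natl.
    apply: ler_sum => i _.
    apply: le_trans (ler_dist_dist _ _) _; rewrite distrC; exact: n2.
  by rewrite mulrCA leNgt gtr_pMr // ltr_pdivrMr // mul1r ltrDl ltr01.
have lv : 0 < `|lincomb v l|.
  rewrite normr_gt0; apply/eqP => /vi l0; move: l1; rewrite big1 ?normr0 => [/eqP|i _].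
    by rewrite eq_sym oner_eq0.
  by rewrite l0 normr0.
have [Ll upil] := upi_lincomb l yL.
have yb i : exists M, U [set n | `|y i n| <= M] by exact: ud_bounded (yL i).
have {yb} [M yM] := choice yb.
set c := `|lincomb v l| in lv.
pose K := \sum_i M i + \sum_i `|v i| + 1.
have M0 i : 0 <= M i.
  by have [n /=] := filter_ex (yM i); apply: le_trans.
have K1 : 1 <= K by rewrite lerDr addr_ge0 // sumr_ge0.
have K0 : 0 < K by lra.
(* At [a n] the two norms differ by at most [h * K], and the norm of [lincomb v (a n)] is at least
   [c - h * K]. Hence [h * K <= e * (c - h * K)] is wanted, and this [h] satisfies
   [h * K * (2 + e) = e * c]. *)
pose h := e * c / (K * (2 + e)).
have h0 : 0 < h by rewrite divr_gt0 ?mulr_gt0 //; lra.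
have lim_norm : U [set n | `| `|lincomb (fun i => y i n) l| - c| <= h].
  have cE : c = unorm U (fun n => lincomb (fun i => y i n) l).
    by rewrite /c -upil ultranormE.
  have lt1 : unorm U (fun n => lincomb (fun i => y i n) l) < c + h by rewrite -cE ltrDl.
  have gt1 : c - h < unorm U (fun n => lincomb (fun i => y i n) l).
    by rewrite -cE gtrBl.
  have b := ud_bounded Ll.
  apply: filterS2 (unorm_ltP UU b lt1) (unorm_gtP UU b gt1) => n /= u1 u2.
  by rewrite ler_norml; lra.
have UM : U [set n | forall i, `|y i n| <= M i] by apply: filter_forall.
have [n /= [[[[_ nbad] nlim] nM] nal]] :=
  filter_ex (filterI (filterI (filterI Ua lim_norm) UM) (al _ h0)).
have d1 : `|lincomb (fun i => y i n) (a n) - lincomb (fun i => y i n) l| <= h * \sum_i M i.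
  rewrite -lincombB; apply: le_trans (lincomb_norm_le _ nal) _.
  by rewrite ler_wpM2l ?(ltW h0) //; apply: ler_sum.
have d2 : `|lincomb v (a n) - lincomb v l| <= h * \sum_i `|v i|.
  by rewrite -lincombB; exact: lincomb_norm_le.
have e1 := le_trans (ler_dist_dist _ _) d1.
have e2 := le_trans (ler_dist_dist _ _) d2.
move: nbad; rewrite /bad.
move: e1 e2 nlim; rewrite -/c.
set p := `|lincomb v (a n)|; set q := `|lincomb _ (a n)|; set r := `|lincomb _ l|.
rewrite !ler_norml => e1 e2 nlim.
have hK : h * K * (2 + e) = e * c.
  by rewrite /h; field; apply/andP; split; apply/eqP; lra.
have hKE : h * K = h * \sum_i M i + h * \sum_i `|v i| + h by rewrite /K; ring.
have hv0 : 0 <= h * \sum_i `|v i| by rewrite mulr_ge0 ?(ltW h0)// sumr_ge0.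
have hM0 : 0 <= h * \sum_i M i by rewrite mulr_ge0 ?(ltW h0)// sumr_ge0.
rewrite ltNge ler_norml => /negP; apply.
have ep : e * (c - h * K) <= e * p by rewrite ler_pM2l //; lra.
have hKe : h * K * 2 + e * (h * K) = e * c by rewrite -hK; ring.
rewrite mulrBr in ep; lra.
Qed.

Lemma ultra_finitely_representable (E : completeNormedModType R -> Prop) :
  (forall n, E (X n)) -> finitely_representable E (ultraspace d).
Proof.
move=> EX Y _ /finite_dimensional_independent [k [v [-> vi]]] e e0.
pose y i := urep (v i).
have vy : v = fun i => upi (y i) by apply/funext => i; rewrite urepK.
have yL i : L (y i) by exact: urepL.
(* Then [2 * t + t * e = e - t < e], which amounts to [(1 + t) / (1 - t) < 1 + e]. *)
pose t := e / (3 + e).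
have t0 : 0 < t by rewrite divr_gt0 //; lra.
have te : t * (3 + e) = e by rewrite divfK //; apply/eqP; lra.
have t1 : t < 1 by rewrite ltr_pdivrMr; lra.
rewrite vy in vi *.
have [n nt] := filter_ex (ultra_lincomb_norm yL t0 vi).
exists (X n); split=> //; exists (lspan (fun i => y i n)); split; first exact: lspan_submod.
apply: le_lt_trans (Banach_Mazur_lspan _ vi nt) _; first by rewrite (ltW t0) t1.
rewrite lte_fin ltr_pdivrMr; last by lra.
move: te; rewrite mulrDr => te.
have : t * e = e - t * 3 by lra.
rewrite mulrBr mulr1 mulrDl mul1r [e * t]mulrC; lra.
Qed.
End ultrafr.

(** * Limits of asymptotic actions *)

Local Open Scope group_scope.

Section topgroup.
Variable G : topologicalGroupType.
Implicit Types (g h : G) (A V : set G).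

Lemma nbhs_mul2 g h A : nbhs (g * h) A ->
  exists V W, [/\ nbhs g V, nbhs h W & forall x y, V x -> W y -> A (x * y)].
Proof.
move=> gA; have /= := @mulg_continuous G (g, h) A gA.
move=> [[V W] /= [gV hW] VW]; exists V, W; split=> // x y Vx Wy.
exact: (VW (x, y)).
Qed.

Lemma mulgl_continuous g : continuous (fun h => g * h).
Proof.
move=> h A /nbhs_mul2 [V [W [gV hW VW]]]; apply: filterS hW => y Wy /=.
by apply: VW => //; exact: nbhs_singleton.
Qed.

Lemma mulgr_continuous h : continuous (fun g => g * h).
Proof.
move=> g A /nbhs_mul2 [V [W [gV hW VW]]]; apply: filterS gV => x Vx /=.
by apply: VW => //; exact: nbhs_singleton.
Qed.

Lemma nbhs_translate g A : nbhs g A <-> nbhs 1 [set h | A (g * h)].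
Proof.
split=> [gA|A1].
  by have := @mulgl_continuous g 1 A; rewrite mulg1 => /(_ gA).
have := @mulgl_continuous g^-1 g [set h | A (g * h)].
rewrite mulVg => /(_ A1) B.
have {}B : nbhs g [set h | A (g * (g^-1 * h))] by [].
by apply: filterS B => h /=; rewrite mulgA mulgV mul1g.
Qed.

Lemma nbhs1_conj h A : nbhs 1 A -> nbhs 1 [set g | A (h^-1 * g * h)].
Proof.
move=> A1; have c : continuous (fun g => h^-1 * g * h).
  move=> g; apply: (@continuous_comp _ _ _ (fun g => h^-1 * g) (fun g => g * h)).
    exact: mulgl_continuous.
  exact: mulgr_continuous.
by have := c 1 A; rewrite mulg1 mulVg => /(_ A1).
Qed.

Lemma nbhs1_sqr A : nbhs 1 A ->
  exists V, nbhs 1 V /\ forall x y, V x -> V y -> A (x * y).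
Proof.
move=> A1; have := @nbhs_mul2 1 1 A; rewrite mulg1 => /(_ A1) [V [W [V1 W1 VW]]].
exists (V `&` W); split; first by apply: filterI.
by move=> x y [Vx _] [_ Wy]; apply: VW.
Qed.

Lemma nbhs1_inv A : nbhs 1 A -> nbhs 1 [set g | A g^-1].
Proof. by move=> A1; have := @invg_continuous G 1 A; rewrite invg1 => /(_ A1). Qed.

Lemma nbhs1_cube A : nbhs 1 A ->
  exists V, [/\ nbhs 1 V, V `<=` A & forall x y z, V x -> V y -> V z -> A (x * y * z)].
Proof.
move=> A1; have [V [V1 VV]] := nbhs1_sqr A1.
have [W [W1 WW]] := nbhs1_sqr V1.
have WV : W `<=` V by move=> x Wx; rewrite -(mulg1 x); apply: WW => //; exact: nbhs_singleton.
have VA : V `<=` A by move=> x Vx; rewrite -(mulg1 x); apply: VV => //; exact: nbhs_singleton.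
exists W; split=> //; first by move=> x /WV /VA.
by move=> x y z Wx Wy Wz; apply: VV; [exact: WW|exact: WV].
Qed.

End topgroup.

Local Close Scope group_scope.

Section limit_action.
Variables (R : realType) (H : topologicalGroupType) (S : set H) (len : H -> nat).
Hypotheses (S_compact : compact S) (S_nbhs : nbhs (1%g : H) S).
Hypothesis len_S : forall s, S s -> (len s <= 1)%N.
Hypothesis lenM : forall g h, (len (g * h)%g <= len g + len h)%N.
Hypothesis lenV : forall g, (len g^-1%g <= len g)%N.
Variables (X : nat -> completeNormedModType R) (A : forall n, H -> X n -> X n).
Arguments A : clear implicits.
Hypothesis A_affine : forall n h, affine_map (A n h).
Hypothesis A_isometry : forall n h x y, `|A n h x - A n h y| = `|x - y|.
(** [A n] stands for an action of the n-th truncated group composed with a section of its projection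
    to [H], hence is multiplicative only on short elements. *)
Hypothesis A_mul : forall k, exists N, forall n, (N <= n)%N ->
  forall g h, (len g <= k)%N -> (len h <= k)%N ->
  forall y, A n (g * h)%g y = A n g (A n h y).
Hypothesis A_equicontinuous : forall e : R, 0 < e -> exists V N, nbhs (1%g : H) V /\
  forall n, (N <= n)%N -> forall v, V v -> `|A n v 0| <= e.
Hypothesis A_bounded : forall h, exists M N, forall n, (N <= n)%N -> `|A n h 0| <= M.

Variables (U : set_system nat) (UU : UltraFilter U).
Hypothesis U_free : forall k, U [set n | (k <= n)%N].

Let UP : ProperFilter U := @ultra_proper _ _ UU.
Let UF : Filter U := @filter_filter _ _ UP.
#[local] Existing Instance UF.
#[local] Existing Instance UP.
Implicit Types y z : forall n, X n.

(** The neighbourhood [V] is common to all coordinates in a set of [U]; continuity of the separate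
    actions gives no such uniformity. *)
Definition equicont y := forall e : R, 0 < e -> exists2 V, nbhs (1%g : H) V &
  U [set n | forall v, V v -> `|A n v (y n) - y n| <= e].

Definition equicont_seq y := ubounded U y /\ equicont y.

Lemma A_equi0 (e : R) : 0 < e -> exists2 V, nbhs (1%g : H) V &
  U [set n | forall v, V v -> `|A n v 0| <= e].
Proof.
move=> e0; have [V [N [V1 h]]] := A_equicontinuous e0; exists V => //.
by apply: filterS (U_free N).
Qed.

Lemma equicont_seq0 : equicont_seq (fun=> 0).
Proof.
split; first by exists 0; apply: filterS (@filterT _ _ UF) => n _ /=; rewrite normr0.
move=> e e0; have [V V1 h] := A_equi0 e0; exists V => //.
by apply: filterS h => n /= h v Vv; rewrite subr0; exact: h.
Qed.

(** The maps [A n v] are affine and not linear. The defect is [a *: A n v 0], so it is the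
    equicontinuity of the orbits of 0 that makes these sequences a linear space. *)
Lemma equicont_seq_lin a y z :
  equicont_seq y -> equicont_seq z -> equicont_seq (fun n => a *: y n + z n).
Proof.
move=> [yb yc] [zb zc]; split; first by apply: (uboundedD UU) => //; exact: uboundedZ.
move=> e e0; have p : 0 < `|a| + `|a| + 1 by rewrite ltr_wpDl // addr_ge0.
have e1 : 0 < e / (`|a| + `|a| + 1) by rewrite divr_gt0.
have [V V1 hV] := yc _ e1; have [W W1 hW] := zc _ e1; have [V' V'1 hV'] := A_equi0 e1.
exists (V `&` W `&` V'); first by apply: filterI => //; apply: filterI.
apply: filterS (filterI hV (filterI hW hV')) => n [/= h1 [h2 h3]] v [[Vv Wv] V'v].
rewrite affine_lin //.
have -> : a *: (A n v (y n) - A n v 0) + A n v (z n) - (a *: y n + z n) =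
   a *: (A n v (y n) - y n) + (A n v (z n) - z n) - a *: A n v 0.
  by rewrite !scalerBr opprD addrACA [RHS]addrAC; congr (_ + _); exact: addrAC.
apply: le_trans (ler_normB _ _) _; apply: le_trans (lerD (ler_normD _ _) (lexx _)) _.
rewrite !normrZ.
have := ler_wpM2l (normr_ge0 a) (h1 _ Vv); have := h2 _ Wv.
have := ler_wpM2l (normr_ge0 a) (h3 _ V'v).
set t := e / _ in e1 *; have -> : e = `|a| * t + `|a| * t + t.
  rewrite -!mulrDl -[X in _ + X]mul1r -mulrDl /t mulrC divfK //; exact: lt0r_neq0.
lra.
Qed.

Lemma equicont_seq_closed y : (forall e, 0 < e ->
    exists2 z, equicont_seq z & U [set n | `|y n - z n| <= e]) -> equicont_seq y.
Proof.
move=> h; split.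
  have [z [[M zM] _] yz] := h 1 ltr01; exists (1 + M).
  apply: filterS2 zM yz => n /= h1 h2; rewrite -(subrK (z n) (y n)).
  by apply: le_trans (ler_normD _ _) (lerD _ _).
move=> e e0; have e3 : 0 < e / 3 by rewrite divr_gt0.
have [z [_ zc] yz] := h _ e3; have [V V1 hV] := zc _ e3; exists V => //.
apply: filterS2 hV yz => n /= h1 h2 v Vv.
have -> : A n v (y n) - y n =
  (A n v (y n) - A n v (z n)) + (A n v (z n) - z n) - (y n - z n).
  by rewrite addrA subrK opprB addrA subrK.
apply: le_trans (ler_normB _ _) _; apply: le_trans (lerD (ler_normD _ _) (lexx _)) _.
rewrite A_isometry; have := h1 _ Vv; lra.
Qed.

Definition limit_data : ultradata R :=
  @UltraData R X U UU U_free equicont_seq (fun y => @proj1 _ _) equicont_seq0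
    equicont_seq_lin equicont_seq_closed.
Local Notation Y := (ultraspace limit_data).
Local Notation lpi := (@upi R limit_data).

(** [v h = h (h^-1 v h)], and conjugation brings a small [v] into [V]. Intersecting with [S] bounds
    the length of [h^-1 v h], as [A_mul] requires. *)
Lemma equicont_seq_A h y : equicont_seq y -> equicont_seq (fun n => A n h (y n)).
Proof.
move=> [[M yM] yc]; split.
  have [M' [N hN]] := A_bounded h; exists (M + M').
  apply: filterS2 yM (U_free N) => n /= h1 h2; rewrite -(subrK (A n h 0) (A n h (y n))).
  apply: le_trans (ler_normD _ _) (lerD _ _); first by rewrite A_isometry subr0.
  exact: hN.
move=> e e0; have [V V1 hV] := yc _ e0.
exists (S `&` [set v | V (h^-1 * v * h)%g]); first by apply: filterI => //; exact: nbhs1_conj.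
have [N hN] := A_mul (len h + 1 + len h).
apply: filterS2 hV (U_free N) => n /= h1 h2 v [Sv Vv].
have ls := len_S Sv.
have l1 : (len (h^-1 * v * h)%g <= len h + 1 + len h)%N.
  apply: leq_trans (lenM _ _) _; rewrite leq_add2r.
  by apply: leq_trans (lenM _ _) _; rewrite leq_add.
have vh : (v * h = h * (h^-1 * v * h))%g by rewrite !mulgA mulgV mul1g.
rewrite -hN //; [|by lia|by lia].
rewrite vh hN //; last by lia.
by rewrite A_isometry; exact: h1.
Qed.

Definition limit_action h (q : Y) : Y := lpi (fun n => A n h (urep q n)).

Lemma limit_actionE h y : equicont_seq y ->
  limit_action h (lpi y) = lpi (fun n => A n h (y n)).
Proof.
move=> yL; apply: upiP.
- by apply: equicont_seq_A; exact: (@urepL R limit_data).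
- exact: equicont_seq_A.
- move=> e e0; apply: filterS ((urep_upi (d := limit_data) yL) e e0) => n /=.
  by rewrite A_isometry.
Qed.

Lemma limit_ind (P : Y -> Prop) : (forall y, equicont_seq y -> P (lpi y)) -> forall q, P q.
Proof. exact: (@ultra_ind R limit_data). Qed.

Lemma upi_eventually y z N : equicont_seq y -> equicont_seq z ->
  (forall n, (N <= n)%N -> y n = z n) -> lpi y = lpi z :> Y.
Proof.
move=> yL zL yz; apply: upiP => // e e0.
by apply: filterS (U_free N) => n /= /yz ->; rewrite subrr normr0 ltW.
Qed.

Lemma limit_actionM g h q : limit_action (g * h)%g q = limit_action g (limit_action h q).
Proof.
elim/limit_ind: q => y yL; have hyL := equicont_seq_A h yL.
rewrite !limit_actionE //.
have [N hN] := A_mul (len g + len h).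
apply: (upi_eventually (N := N)); [exact: equicont_seq_A|exact: equicont_seq_A|].
by move=> n Nn; apply: hN => //; lia.
Qed.

(** [A n 1] is not assumed to be the identity. For large [n] it is idempotent because [1 * 1 = 1],
    and an idempotent isometry is the identity. *)
Lemma limit_action1 q : limit_action 1%g q = q.
Proof.
elim/limit_ind: q => y yL; rewrite limit_actionE //.
have [N hN] := A_mul (len 1%g).
apply: (upi_eventually (N := N)) => //; first exact: equicont_seq_A.
move=> n Nn; apply/eqP; rewrite -subr_eq0 -normr_eq0 -(A_isometry 1%g).
by rewrite -hN // mulg1 subrr normr0.
Qed.

Lemma limit_action_affine h : affine_map (limit_action h).
Proof.
move=> t; elim/limit_ind => y yL; elim/limit_ind => z zL.
have Z a w : equicont_seq w -> equicont_seq (fun n => a *: w n) by exact: (@ud_Z R limit_data).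
have D w w' : equicont_seq w -> equicont_seq w' -> equicont_seq (fun n => w n + w' n).
  exact: (@ud_D R limit_data).
have hy := equicont_seq_A h yL; have hz := equicont_seq_A h zL.
rewrite (limit_actionE h yL) (limit_actionE h zL).
rewrite !scaleE // (addE (d := limit_data) (Z t y yL) (Z (1 - t) z zL)).
rewrite (addE (d := limit_data) (Z t _ hy) (Z (1 - t) _ hz)).
rewrite limit_actionE; last exact: D (Z t y yL) (Z (1 - t) z zL).
by apply: upi_ext => n; exact: A_affine.
Qed.

Lemma limit_norm y (r : R) : equicont_seq y -> U [set n | `|y n| <= r] -> `|lpi y : Y| <= r.
Proof.
move=> yL yr; rewrite (ultranormE (d := limit_data)) //; apply: unorm_le => //.
by case: yL.
Qed.

Lemma limit_subE y z : equicont_seq y -> equicont_seq z ->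
  lpi y - lpi z = lpi (fun n => y n - z n) :> Y.
Proof.
move=> yL zL; rewrite oppE // addE //; exact: (@ud_N R limit_data).
Qed.

Lemma equicont_seqB y z : equicont_seq y -> equicont_seq z ->
  equicont_seq (fun n => y n - z n).
Proof.
by move=> yL zL; apply: (@ud_D R limit_data) => //; exact: (@ud_N R limit_data).
Qed.

Lemma limit_action_isometry h p q : `|limit_action h p - limit_action h q| = `|p - q|.
Proof.
elim/limit_ind: p => y yL; elim/limit_ind: q => z zL.
have hy := equicont_seq_A h yL; have hz := equicont_seq_A h zL.
rewrite !limit_actionE // !limit_subE // !(ultranormE (d := limit_data)) /=;
  try exact: equicont_seqB.
rewrite /unorm; congr inf; apply/seteqP; split=> r /=; apply: filterS => n /=;
  by rewrite A_isometry.
Qed.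

(** As the action is isometric, continuity of the orbit maps at 1 is enough, and the sequences of
    the ultraproduct were selected for it. *)
Lemma limit_action_continuous : continuous (fun p : H * Y => limit_action p.1 p.2).
Proof.
move=> [g q]; apply/cvgrPdist_le => e e0 /=.
have e2 : 0 < e / 2 by rewrite divr_gt0.
have [V V1 hV] : exists2 V, nbhs (1%g : H) V &
    forall v, V v -> `|q - limit_action v q| <= e / 2.
  elim/limit_ind: q => y yL; have [V V1 hV] := (proj2 yL) _ e2; exists V => // v Vv.
  have vL := equicont_seq_A v yL.
  rewrite limit_actionE // limit_subE //; apply: limit_norm; first exact: equicont_seqB.
  by apply: filterS hV => n /= h; rewrite distrC; exact: h.
exists ([set h | V (g^-1 * h)%g], ball q (e / 2)) => /=.
  split; last by apply: nbhsx_ballx.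
  by apply/nbhs_translate; apply: filterS V1 => v /=; rewrite mulgA mulVg mul1g.
move=> [h p] [/= Vh]; rewrite -ball_normE /= => pq.
have -> : limit_action g q - limit_action h p =
   (limit_action g q - limit_action h q) + (limit_action h q - limit_action h p).
  by rewrite addrA subrK.
apply: le_trans (ler_normD _ _) _; rewrite limit_action_isometry.
rewrite -(mul1g h) -(mulgV g) -mulgA limit_actionM limit_action_isometry.
have := hV _ Vh; lra.
Qed.

(* Compactness of [S] and equicontinuity turn displacements by elements [s_n]
   into a displacement by a cluster point of the [s_n]. *)
Lemma limit_no_fixed_point :
  (forall r : R, exists N, forall n, (N <= n)%N -> forall x : X n, `|x| <= r ->
     exists2 s, S s & 2^-1 < `|A n s x - x|) ->
  forall q, ~ forall h, limit_action h q = q.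
Proof.
move=> mv q; elim/limit_ind: q => y yL qfix.
have [[M yM] yc] := yL.
have [N hN] := mv M.
have S1 : exists s, S s by exists 1%g; exact: nbhs_singleton.
(* Where [n] is too small or [y n] too large, the element [s n] of [S] is arbitrary. *)
have /choice [s hs] : forall n, exists s, S s /\
    ((N <= n)%N -> `|y n| <= M -> 2^-1 < `|A n s (y n) - y n|).
  move=> n; have [Nn|nN] := leqP N n; last first.
    by have [s Ss] := S1; exists s; split.
  have [yM'|nyM] := leP (`|y n|) M; last by have [s Ss] := S1; exists s; split.
  by have [s Ss hh] := hN _ Nn _ yM'; exists s; split.
have UsS : U (s @^-1` S) by apply: filterS (@filterT _ _ UF) => n _; case: (hs n).
have sU : UltraFilter (s @ U).
  split; first exact: fmap_proper_filter.
  move=> G GP sG; apply/seteqP; split=> // B GB.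
  have [//|h] := in_ultra_setVsetC (s @^-1` B) UU.
  have /sG GB' : (s @ U) (~` B) by [].
  by have [x []] := filter_ex (filterI GB GB').
have := S_compact; rewrite compact_ultra => /(_ _ sU UsS) [t [St /= st]].
have e4 : 0 < 4^-1 :> R by rewrite invr_gt0.
have [V V1 hV] := yc _ e4.
have Us : U [set n | V (t^-1 * s n)%g /\ S (t^-1 * s n)%g].
  apply: (st [set g | V (t^-1 * g)%g /\ S (t^-1 * g)%g]).
  apply/nbhs_translate; apply: filterS (filterI V1 S_nbhs) => v [Vv Sv] /=.
  by rewrite !mulgA mulVg mul1g.
have tL := equicont_seq_A t yL.
have /= := upi_eq (d := limit_data) tL yL; rewrite -limit_actionE // => /(_ (qfix t)) tnull.
have [N1 hN1] := A_mul 1%N.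
have [n /= [[[[h1 h2] h3] [h4 h5]] [h6 h7]]] := filter_ex
  (filterI (filterI (filterI (filterI (U_free N) (U_free N1)) yM) Us) (filterI hV (tnull _ e4))).
have [_ /(_ h1 h3)] := hs n.
(* [s n] is [t] times [t^-1 s n], both of length at most 1. The former moves [y n] by at most 1/4
   because it fixes the limit, the latter by at most 1/4 by equicontinuity. *)
rewrite -[X in A n X](mul1g (s n)) -(mulgV t) -mulgA hN1 //; [|exact: len_S|exact: len_S].
have := h6 _ h4; set x := y n; set v := (t^-1 * s n)%g => vx.
have -> : A n t (A n v x) - x = (A n t (A n v x) - A n t x) + (A n t x - x).
  by rewrite addrA subrK.
move=> lt1; have := lt_le_trans lt1 (ler_normD _ _); rewrite A_isometry.
rewrite /= in h7; lra.
Qed.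

Lemma property_F_limit (E : completeNormedModType R -> Prop) :
  closed_under_finite_representability E -> (forall n, E (X n)) -> property_F E H ->
  ~ (forall r : R, exists N, forall n, (N <= n)%N -> forall x : X n, `|x| <= r ->
     exists2 s, S s & 2^-1 < `|A n s x - x|).
Proof.
move=> Ecl EX HF mv.
have EY : E Y by apply: Ecl; exact: (ultra_finitely_representable (d := limit_data)).
have [|q hq] := HF Y EY limit_action _ limit_action_continuous; last first.
  exact: (limit_no_fixed_point mv) hq.
split; [exact: limit_action1|exact: limit_actionM|exact: limit_action_affine|].
exact: limit_action_isometry.
Qed.
End limit_action.

(** * Points of comparable displacement *)

Lemma geometric_cvg (R : realType) (X : completeNormedModType R) (x : nat -> X) (c : R) :
  0 < c -> (forall k, `|x k.+1 - x k| <= c * 2^-1 ^+ k) ->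
  exists l : X, (x k @[k --> \oo] --> l)%classic.
Proof.
move=> c0 xk; apply/cvg_ex; apply: cauchy_cvg; apply/cauchyP => e e0.
have [k ke] := half_exp_lt (divr_gt0 (divr_gt0 e0 c0) (ltr0Sn R 4)).
exists (x k); exists k => // m /= km; rewrite -ball_normE /=.
have := @geometric_sum_le _ X (fun k => c^-1 *: x k) k m km.
rewrite -scalerBr normrZ gtr0_norm ?invr_gt0 // => h.
have {h} : c^-1 * `|x k - x m| <= 2^-1 ^+ k *+ 4.
  apply: h => j _; rewrite -scalerBr normrZ gtr0_norm ?invr_gt0 // ler_pdivrMl //.
  apply: le_trans (xk j) _; rewrite ler_pM2l //.
  have : 0 < (2^-1 : R) ^+ j by rewrite exprn_gt0.
  lra.
rewrite ler_pdivrMl // => h; apply: le_lt_trans h _.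
move: ke; rewrite !ltr_pdivlMr // => ke; apply: le_lt_trans ke.
have z0 : 0 < (2^-1 : R) ^+ k by rewrite exprn_gt0.
by rewrite [c * _]mulrC ler_pM2r //; lra.
Qed.

(* Otherwise one could iteratively halve the displacement while moving by
   geometrically decreasing distances, and the limit would be a fixed point. *)
Lemma rough_point_selection (R : realType) (X : completeNormedModType R)
    (G : groupType) (S : set G) (alpha : G -> X -> X) (K : R) :
  affine_isometric_action alpha -> generating S ->
  (forall x, exists r, forall s, S s -> `|alpha s x - x| <= r) ->
  ~ (exists x, forall g, alpha g x = x) -> 0 < K ->
  exists x r, [/\ 0 < r, forall s, S s -> `|alpha s x - x| <= r &
    forall y, `|y - x| <= K * r -> exists2 s, S s & r / 2 < `|alpha s y - y|].
Proof.
move=> [a1 aM aA aI] Sgen bd nofix K0; apply: contrapT => nex.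
pose D x r := forall s, S s -> `|alpha s x - x| <= r.
have step (xr : X * R) : exists y, 0 < xr.2 -> D xr.1 xr.2 ->
    `|y - xr.1| <= K * xr.2 /\ D y (xr.2 / 2).
  apply: contrapT => /forallNP h; apply: nex; exists xr.1, xr.2.
  have h' y : [/\ 0 < xr.2, D xr.1 xr.2 & `|y - xr.1| <= K * xr.2 -> ~ D y (xr.2 / 2)].
    have /not_implyP[p1 /not_implyP[p2 /not_andP p3]] := h y.
    by split=> // p4; case: p3.
  have [p1 p2 _] := h' 0; split=> // y yK; have [_ _ /(_ yK)] := h' y.
  move=> /existsNP[s /not_implyP[Ss /negP]]; rewrite -ltNge => hs.
  by exists s.
have [f fP] := choice step.
have [r1 hr1] := bd 0; pose r0 := Num.max r1 1.
have r00 : 0 < r0 by rewrite lt_max ltr01 orbT.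
(* A point together with a bound on its displacement. The first bound [r0] is at least 1, which
   keeps all of them positive. *)
pose xr := fix xr k : X * R := if k is k'.+1 then (f (xr k'), (xr k').2 / 2) else (0, r0).
have xr2 k : (xr k).2 = r0 * 2^-1 ^+ k.
  by elim: k => [|k IH] /=; rewrite ?expr0 ?mulr1 // IH exprSr mulrA.
have xr2p k : 0 < (xr k).2 by rewrite xr2 mulr_gt0 // exprn_gt0.
have xrD k : D (xr k).1 (xr k).2.
  elim: k => [|k IH] /=; first by move=> s /hr1 h; rewrite le_max h.
  by have [] := fP (xr k) (xr2p k) IH.
have [|k|l xl] := @geometric_cvg R X (fun k => (xr k).1) (K * r0); first exact: mulr_gt0.
  by have [h _] := fP (xr k) (xr2p k) (xrD k); rewrite -mulrA -xr2.
have lfix s : S s -> alpha s l = l.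
  move=> Ss; apply/eqP; rewrite -subr_eq0 -normr_le0; apply/ler_addgt0Pr => e e0.
  have e3 : 0 < e / 3 by rewrite divr_gt0.
  have [k ke] := half_exp_lt (divr_gt0 e3 r00).
  have /cvgrPdist_le /(_ _ e3) [N _ hN] := xl.
  have h1 := hN (maxn N k) (leq_maxl _ _); rewrite /= in h1.
  set j := maxn N k in h1.
  have h2 := xrD j s Ss.
  have h3 : (xr j).2 <= e / 3.
    rewrite xr2 mulrC -ler_pdivlMr //; apply: le_trans (ltW ke).
    by rewrite ler_wiXn2l ?leq_maxr //; lra.
  rewrite (_ : alpha s l - l = (alpha s l - alpha s (xr j).1) +
     (alpha s (xr j).1 - (xr j).1) - (l - (xr j).1)); last first.
    by rewrite addrA subrK opprB addrA subrK.
  apply: le_trans (ler_normB _ _) _; apply: le_trans (lerD (ler_normD _ _) (lexx _)) _.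
  rewrite aI; lra.
apply: nofix; exists l => g; have [w <-] := Sgen g; rewrite /eval_word.
elim: w => [|[b s] w IH]; first by rewrite big_nil a1.
rewrite big_cons aM IH /=.
have fs : alpha (val s) l = l by apply: lfix; exact: set_valP.
by case: b => //; rewrite -{1}fs -aM mulVg a1.
Qed.

(** * Almost invariant means without Haar measure *)

Local Open Scope group_scope.

Section covers.
Variables (G : groupType) (W : set G).
Implicit Types (F : seq G) (A : set G).

Definition covers F A := forall a, A a -> exists2 f, f \in F & W (f^-1 * a).
Definition min_cover F A :=
  covers F A /\ forall F', covers F' A -> (size F <= size F')%N.
(** The translates [f W] and [f' W] meet. *)
Definition near_centers f f' := exists a, W (f^-1 * a) /\ W (f'^-1 * a).

Lemma min_cover_exists F A : covers F A -> exists F', min_cover F' A.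
Proof.
move=> FA; pose P k := `[< exists2 F', covers F' A & size F' = k >].
have exP : exists k, P k by exists (size F); apply/asboolP; exists F.
case: (ex_minnP exP) => k /asboolP [F' F'A <-] kmin.
by exists F'; split=> // F'' F''A; apply: kmin; apply/asboolP; exists F''.
Qed.

Lemma covers_translate g F A : covers F A ->
  covers [seq g * f | f <- F] [set g * a | a in A].
Proof.
move=> FA _ [a Aa <-]; have [f fF fa] := FA a Aa; exists (g * f); first exact: map_f.
by rewrite invgM -mulgA mulKg.
Qed.

Lemma min_cover_translate g F A : min_cover F A ->
  min_cover [seq g * f | f <- F] [set g * a | a in A].
Proof.
move=> [FA Fmin]; split; first exact: covers_translate.
move=> F' /(@covers_translate g^-1) F'A.
rewrite size_map -(size_map (fun f => g^-1 * f) F'); apply: Fmin.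
move=> a Aa; apply: F'A; exists (g * a); last by rewrite mulKg.
by exists a.
Qed.

(** A centre whose translate misses [A] could be dropped. *)
Lemma min_cover_meets F A f : min_cover F A -> f \in F ->
  exists2 a, A a & W (f^-1 * a).
Proof.
move=> [FA Fmin] fF; apply: contrapT => nf.
have : (size F <= size (rem f F))%N.
  apply: Fmin => a Aa; have [f' f'F f'a] := FA a Aa; exists f' => //.
  have [e|ne] := eqVneq f' f; first by case: nf; exists a; rewrite -?e.
  by move: f'F; rewrite (perm_mem (perm_to_rem fF)) inE (negPf ne).
rewrite size_rem // -ltnS prednK ?ltnn //; by case: F fF {FA Fmin nf}.
Qed.

(* If Hall's condition failed for a set [T] of centers of [F], exchanging [T]
   for its neighbours in [F'] would give a smaller cover. *)
Lemma min_cover_matching F F' A a0 : A a0 -> min_cover F A -> covers F' A ->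
  exists s : 'I_(size F) -> 'I_(size F'), injective s /\
    forall i : 'I_(size F), near_centers (nth 1 F i) (nth 1 F' (s i)).
Proof.
move=> Aa0 [FA Fmin] F'A.
have F'0 : (0 < size F')%N by have [f + _] := F'A a0 Aa0; case: (F').
pose r (i : 'I_(size F)) (j : 'I_(size F')) :=
  `[< near_centers (nth 1 F i) (nth 1 F' j) >].
have [|s [s_inj sr]] := @hall_matching _ _ r (Ordinal F'0); last first.
  by exists s; split=> // i; apply/asboolP; exact: sr.
move=> T; set N := finset.finset _; rewrite leqNgt; apply/negP => NT.
pose F'' := [seq nth 1 F (i : 'I_(size F)) | i <- enum (~: T)%SET] ++
  [seq nth 1 F' (j : 'I_(size F')) | j <- enum N].
have : (size F <= size F'')%N.
  apply: Fmin => a Aa; have [f fF fa] := FA a Aa.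
  have fi : (index f F < size F)%N by rewrite index_mem.
  have [iT|iT] := boolP (Ordinal fi \in T).
    have [f' f'F f'a] := F'A a Aa.
    have f'i : (index f' F' < size F')%N by rewrite index_mem.
    exists f' => //; rewrite mem_cat; apply/orP; right; apply/mapP.
    exists (Ordinal f'i); last by rewrite /= nth_index.
    rewrite mem_enum !inE; apply/existsP; exists (Ordinal fi); rewrite iT /=.
    by apply/asboolP; rewrite /= !nth_index //; exists a.
  exists f => //; rewrite mem_cat; apply/orP; left; apply/mapP.
  by exists (Ordinal fi); [rewrite mem_enum inE|rewrite /= nth_index].
rewrite size_cat !size_map -!cardE leqNgt => /negP; apply.
rewrite -[X in (_ < X)%N](card_ord (size F)) -(finset.cardsC T) addnC ltn_add2r.
exact: NT.
Qed.
End covers.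

(** * Sets interpolating between [V 0] and its square *)

Section layers.
Variables (G : groupType) (V : nat -> set G) (N : nat).
Hypothesis V1 : forall m, V m 1.
Hypothesis V3 : forall m x y z, (m < N)%N ->
  V m.+1 x -> V m.+1 y -> V m.+1 z -> V m (x * y * z).

(** A letter from [V m] has weight 2^-m, counted in units of 2^-N so that weights are natural
    numbers. *)
Definition weight (s : seq (nat * G)) := (\sum_(l <- s) 2 ^ (N - l.1))%N.
Definition letters (s : seq (nat * G)) :=
  forall l, l \in s -> (l.1 <= N)%N /\ V l.1 l.2.
Definition wprod (s : seq (nat * G)) : G := \prod_(l <- s) l.2.

Lemma V_decr k m : (k <= m <= N)%N -> V m `<=` V k.
Proof.
move=> /andP[]; elim: m => [|m IH]; first by rewrite leqn0 => /eqP -> _.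
rewrite leq_eqVlt => /orP[/eqP -> _ x //|km mN x Vx]; apply: (IH km (ltnW mN)).
by rewrite -(mulg1 x) -(mulg1 (x * 1)); apply: V3.
Qed.

Lemma weight_nil : weight [::] = 0%N. Proof. exact: big_nil. Qed.
Lemma weight_cons x s : weight (x :: s) = (2 ^ (N - x.1) + weight s)%N.
Proof. exact: big_cons. Qed.

(** [x] is the letter at which the running weight, started at [c], reaches [h], or the last letter
    if it never does. As the total is below [h + h], less than [h] is left after it. *)
Lemma split_weight (h c : nat) s : s != [::] -> (c < h)%N ->
  (c + weight s < h + h)%N ->
  exists p x q, [/\ s = p ++ x :: q, (c + weight p < h)%N & (weight q < h)%N].
Proof.
elim: s c => [//|x s IH] c _ ch; rewrite weight_cons; set w := expn _ _ => cs.
have [s0|s0] := eqVneq s [::].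
  exists [::], x, [::]; rewrite s0 weight_nil addn0; split=> //.
  exact: leq_ltn_trans ch.
have [hx|hx] := leqP h (c + w)%N.
  by exists [::], x, s; rewrite weight_nil addn0; split=> //; lia.
have [|p [y [q [-> pc qh]]]] := IH (c + w)%N s0 hx; first by lia.
by exists (x :: p), y, q; rewrite weight_cons -/w; split=> //; lia.
Qed.

Lemma weight_cat s t : weight (s ++ t) = (weight s + weight t)%N.
Proof. by rewrite /weight big_cat. Qed.

(* The halving argument behind the Birkhoff-Kakutani metrization theorem. *)
Lemma wprod_small s k : (k <= N)%N -> letters s -> (weight s < 2 ^ (N - k))%N ->
  V k (wprod s).
Proof.
have [n] := ubnP (size s); elim: n s k => // n IH s k sn kN sl sw.
have [s0|s0] := eqVneq s [::]; first by rewrite s0 /wprod big_nil.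
have kN' : (k < N)%N.
  rewrite ltn_neqAle kN andbT; apply/eqP => e; move: sw; rewrite e subnn expn0.
  case: (s) s0 => // x s' _; rewrite weight_cons.
  by have := expn_gt0 2 (N - x.1)%N; lia.
have h0 : (0 < 2 ^ (N - k.+1))%N by rewrite expn_gt0.
have e2 : (2 ^ (N - k) = 2 ^ (N - k.+1) + 2 ^ (N - k.+1))%N.
  by rewrite -(subnSK kN') expnS mul2n addnn.
have [|p [x [q [sE pc qh]]]] := split_weight s0 h0; first by rewrite add0n -e2.
have [xN Vx] : (x.1 <= N)%N /\ V x.1 x.2 by apply: sl; rewrite sE mem_cat mem_head orbT.
have szs : (size p + size q < n)%N by move: sn; rewrite sE size_cat /= addnS ltnS.
rewrite sE /wprod big_cat big_cons /= mulgA; apply: V3 => //.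
- apply: IH => //; first exact: leq_ltn_trans (leq_addr _ _) szs.
  by move=> l lp; apply: sl; rewrite sE mem_cat lp.
(* A letter of level at most [k] would exhaust the weight [2 ^ (N - k)] by itself. *)
- apply: (@V_decr k.+1 x.1) => //; rewrite xN andbT.
  rewrite ltnNge; apply/negP => xk; move: sw; rewrite sE weight_cat weight_cons.
  have h : (2 ^ (N - k) <= 2 ^ (N - x.1))%N by rewrite leq_exp2l // leq_sub2l.
  apply/negP; rewrite -leqNgt; apply: leq_trans h _.
  by rewrite addnCA leq_addr.
- apply: IH => //; first exact: leq_ltn_trans (leq_addl _ _) szs.
  by move=> l lp; apply: sl; rewrite sE mem_cat inE lp !orbT.
Qed.

(** In Birkhoff-Kakutani terms, the ball of radius i 2^-N times [V 0]. Translating by an element of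
    [V m] costs [2 ^ (N - m)] layers, and the layers with [i < 2 ^ N] stay inside the product of
    [V 0] with itself. *)
Definition layer i : set G := [set g | exists s a,
  [/\ letters s, (weight s <= i)%N, V 0%N a & g = wprod s * a]].

Lemma layer0 : V 0%N `<=` layer 0.
Proof.
move=> a Va; exists [::], a; split=> //; first by rewrite weight_nil.
by rewrite /wprod big_nil mul1g.
Qed.

Lemma layer_mono i j : (i <= j)%N -> layer i `<=` layer j.
Proof. by move=> ij _ [s [a [sl si Va ->]]]; exists s, a; split=> //; lia. Qed.

Lemma layer_mul m i v g : (m <= N)%N -> V m v -> layer i g ->
  layer (i + 2 ^ (N - m))%N (v * g).
Proof.
move=> mN Vv [s [a [sl si Va ->]]]; exists ((m, v) :: s), a; split=> //.
- by move=> l; rewrite inE => /orP[/eqP -> //|/sl].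
- by rewrite weight_cons /=; lia.
- by rewrite /wprod big_cons mulgA.
Qed.

Lemma layer_sub i g : (i < 2 ^ N)%N -> layer i g ->
  exists x y, [/\ V 0%N x, V 0%N y & g = x * y].
Proof.
move=> iN [s [a [sl si Va ->]]]; exists (wprod s), a; split=> //.
by apply: wprod_small => //; rewrite subn0; lia.
Qed.
End layers.

Local Close Scope group_scope.

Section matching_sum.
Variables (R : realType) (X : normedModType R) (G : groupType).
Variables (alpha : G -> X -> X) (x : X) (W : set G) (eta D : R).
Hypothesis alpha_action : affine_isometric_action alpha.
Hypothesis W_small : forall w, W w -> `|alpha w x - x| <= eta.

Lemma alpha_dist g w : W (g^-1 * w)%g -> `|alpha g x - alpha w x| <= eta.
Proof.
case: alpha_action => _ aM _ aI Wg.
rewrite -[w in X in _ - X](mulVKg g) aM aI distrC.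
exact: W_small.
Qed.

Lemma near_centers_dist f f' : near_centers W f f' ->
  `|alpha f x - alpha f' x| <= eta + eta.
Proof.
move=> [a [fa f'a]].
rewrite -(subrK (alpha a x) (alpha f x)) -addrA; apply: le_trans (ler_normD _ _) _.
by apply: lerD; [exact: alpha_dist|rewrite distrC; exact: alpha_dist].
Qed.

(** Each matched pair of centres costs at most [eta + eta], and each unmatched centre of [F'] at
    most [D]. *)
Lemma matching_sum_dist F F' (s : 'I_(size F) -> 'I_(size F')) :
  injective s -> (forall i : 'I_(size F), near_centers W (nth 1%g F i) (nth 1%g F' (s i))) ->
  (forall f, f \in F' -> `|alpha f x - x| <= D) ->
  `|\sum_(f <- F) (alpha f x - x) - \sum_(f <- F') (alpha f x - x)| <=
     (eta + eta) *+ size F + D *+ (size F' - size F).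
Proof.
move=> s_inj sF F'D.
rewrite (big_nth 1%g) big_mkord [X in _ - X](big_nth 1%g) big_mkord.
set u := fun j : 'I_(size F') => alpha (nth 1%g F' j) x - x.
rewrite -(subrK (\sum_i u (s i)) (\sum_(i < size F) _)) -addrA.
apply: le_trans (ler_normD _ _) (lerD _ _).
  rewrite -sumrB; apply: le_trans (ler_norm_sum _ _ _) _.
  rewrite -[X in _ *+ X]card_ord -sumr_const; apply: ler_sum => i _.
  by rewrite /u opprB addrA subrK; exact: near_centers_dist.
rewrite distrC; have := @norm_sum_injection R X _ _ s u D s_inj.
rewrite !card_ord; apply=> j; apply: F'D; exact: mem_nth.
Qed.
End matching_sum.

(** Shifting drops the first [s] terms and adds [s] terms at the end, each at most [P]. *)
Lemma sum_shift_le (p : nat -> nat) (T s P : nat) :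
  (forall i, (i < T + s)%N -> (p i <= P)%N) ->
  (\sum_(0 <= i < T) p (i + s) <= \sum_(0 <= i < T) p i + s * P)%N.
Proof.
move=> pP; apply: leq_trans (_ : \sum_(0 <= i < T + s) p i <= _)%N.
  rewrite [X in (_ <= X)%N](big_cat_nat (n := s)) ?leq_addl //=.
  by rewrite -{3}(add0n s) big_addn addnK leq_addl.
rewrite (big_cat_nat (n := T)) ?leq_addr //= leq_add2l.
apply: leq_trans (_ : \sum_(T <= i < T + s) P <= _)%N; last first.
  by rewrite sum_nat_const_nat addKn.
rewrite big_nat_cond [X in (_ <= X)%N]big_nat_cond; apply: leq_sum => i.
by rewrite andbT => /andP[_ /pP].
Qed.

(** * Almost invariant points from minimal covers *)

Section averaging.
Variables (R : realType) (X : normedModType R) (G : groupType).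
Variables (alpha : G -> X -> X) (x : X) (W : set G) (eta D : R).
Variables (V : nat -> set G) (N : nat) (F0 hs : seq G).
Hypothesis alpha_action : affine_isometric_action alpha.
Hypothesis W_small : forall w, W w -> `|alpha w x - x| <= eta.
Hypothesis V1 : forall m, V m 1%g.
Hypothesis V3 : forall m a b c, (m < N)%N ->
  V m.+1 a -> V m.+1 b -> V m.+1 c -> V m (a * b * c)%g.
Hypothesis N_gt0 : (0 < N)%N.
Let V00 : set G := [set g | exists a b, [/\ V 0%N a, V 0%N b & g = (a * b)%g]].
Hypothesis F0_covers : covers W F0 V00.
Hypothesis hs_covers : covers (V 0%N) hs V00.
Hypothesis V00_bounded : forall g, V00 g -> `|alpha g x - x| <= D.

Local Notation A := (layer V N).

Let eta_ge0 : 0 <= eta.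
Proof.
have [f _ /W_small] : exists2 f, f \in F0 & W (f^-1 * (1 * 1))%g.
  by apply: F0_covers; exists 1%g, 1%g; split.
exact: le_trans (normr_ge0 _).
Qed.

Let D_ge0 : 0 <= D.
Proof.
apply: le_trans (V00_bounded _); first exact: normr_ge0.
by exists 1%g, 1%g; split.
Qed.

Let A_V00 i : (i < 2 ^ N)%N -> A i `<=` V00.
Proof. by move=> iN g /(layer_sub V1 V3 iN). Qed.

Let A1 i : A i 1%g.
Proof. exact: (layer_mono (leq0n i) (layer0 _ (V1 _))). Qed.

Lemma layer_covers : exists F : nat -> seq G,
  forall i, (i < 2 ^ N)%N -> min_cover W (F i) (A i).
Proof.
suff h i : exists F, (i < 2 ^ N)%N -> min_cover W F (A i).
  by have [F hF] := choice h; exists F.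
have [iN|] := boolP (i < 2 ^ N)%N; last by exists [::].
have [|F hF] := @min_cover_exists _ W F0 (A i); last by exists F.
by move=> a /(A_V00 iN); exact: F0_covers.
Qed.

(** [x'] is the mean of [alpha f x] over the centres [f], with multiplicity, of minimal covers [F i]
    of the lower half of the layers. For [v] in [V m], both [F i] and [v F i] match into [F (i + s)]
    with [s = 2 ^ (N - m)], up to [p (i + s) - p i] unmatched centres. These differences telescope
    to at most [s] terms bounded by [size hs * p 0], against a total of at least [T * p 0] centres.
    [W] enters the bounds only through [eta]. *)
Lemma almost_invariant_mean : exists x', `|x' - x| <= D + eta /\
  forall m v, (0 < m <= N)%N -> V m v ->
    `|alpha v x' - x'| <= 4 * eta + 4 * (D + eta) * (size hs)%:R * 2^-1 ^+ m.
Proof.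
have [F Fmin] := layer_covers.
(* Only half of the layers, so that [i + s] stays below [2 ^ N] when [m > 0]; the ratio of [s] to
   [T] is 2 * 2^-m. *)
pose T := (2 ^ N.-1)%N.
have T0 : (0 < T)%N by rewrite expn_gt0.
have TN : (T + T = 2 ^ N)%N by rewrite /T addnn -mul2n -expnS prednK.
have T_lt i : (i < T)%N -> (i < 2 ^ N)%N by rewrite -TN => /ltn_addr.
pose p i := size (F i).
have FD i f : (i < 2 ^ N)%N -> f \in F i -> `|alpha f x - x| <= D + eta.
  move=> iN fF; have [a Aa fa] := min_cover_meets (Fmin i iN) fF.
  rewrite -(subrK (alpha a x) (alpha f x)) -addrA addrC.
  apply: le_trans (ler_normD _ _) (lerD _ _).
    by apply: V00_bounded; exact: A_V00 Aa.
  exact: (alpha_dist alpha_action W_small).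
have F0min : (0 < 2 ^ N)%N by rewrite expn_gt0.
have p0 : (0 < p 0)%N.
  have [f + _] := (Fmin 0%N F0min).1 1%g (A1 0%N).
  by rewrite /p; case: (F 0%N).
have p_ge i : (i < 2 ^ N)%N -> (p 0 <= p i)%N.
  move=> iN; apply: (Fmin 0%N F0min).2 => a Aa; apply: (Fmin i iN).1.
  exact: layer_mono (leq0n i) _ Aa.
(* Products of the centres in [hs] with those of [F 0] give a cover of every layer. This replaces
   the comparison of two Haar measures. *)
have p_le i : (i < 2 ^ N)%N -> (p i <= size hs * p 0)%N.
  move=> iN; rewrite /p -(size_allpairs (fun h f => (h * f)%g) hs (F 0%N)).
  apply: (Fmin i iN).2 => a /(A_V00 iN) /hs_covers [h hhs Vh].
  have [f fF Wf] := (Fmin 0%N F0min).1 _ (layer0 _ Vh).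
  exists (h * f)%g; first exact: allpairs_f.
  by rewrite invgM -mulgA.
pose Fs := flatten [seq F i | i <- iota 0 T].
have szFs : size Fs = (\sum_(0 <= i < T) p i)%N.
  by rewrite size_flatten sumnE /shape -map_comp big_map /index_iota subn0.
pose M : R := (size Fs)%:R.
have M_ge : (T * p 0 <= size Fs)%N.
  rewrite szFs -[T in (T * _)%N]subn0 -sum_nat_const_nat big_nat_cond.
  rewrite [X in (_ <= X)%N]big_nat_cond; apply: leq_sum => i /andP[/andP[_ iT] _].
  exact: p_ge (T_lt _ iT).
have M0 : 0 < M by rewrite ltr0n; apply: leq_trans M_ge; rewrite muln_gt0 T0.
have sumFs (Y : zmodType) (w : G -> Y) :
    \sum_(f <- Fs) w f = \sum_(0 <= i < T) \sum_(f <- F i) w f.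
  by rewrite big_flatten big_map /index_iota subn0.
pose x' := \sum_(f <- Fs) M^-1 *: alpha f x.
have sumM : \sum_(f <- Fs) M^-1 = 1 :> R.
  by rewrite big_const_seq count_predT iter_addr_0 -[LHS]mulr_natr mulVf ?gt_eqF.
have x'E : x' - x = M^-1 *: \sum_(f <- Fs) (alpha f x - x).
  rewrite scaler_sumr /x'; under [RHS]eq_bigr do rewrite scalerBr.
  by rewrite sumrB -scaler_suml sumM scale1r.
have [a1 aM aA aI] := alpha_action.
exists x'; split.
  rewrite x'E normrZ gtr0_norm ?invr_gt0 // ler_pdivrMl //.
  apply: le_trans (ler_norm_sum _ _ _) _; rewrite mulr_natl.
  have FsD f : f \in Fs -> `|alpha f x - x| <= D + eta.
    by case/flattenP => _ /mapP[i + ->]; rewrite mem_iota => iT; exact: FD (T_lt i iT).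
  rewrite big_seq; apply: le_trans (ler_sum _ FsD) _.
  by rewrite -big_seq big_const_seq count_predT iter_addr_0.
move=> m v /andP[m0 mN] Vv.
pose s := (2 ^ (N - m))%N.
have sT : (s <= T)%N by rewrite /s /T leq_exp2l //; lia.
have is_lt i : (i < T)%N -> (i + s < 2 ^ N)%N by rewrite -TN => iT; lia.
pose u g := alpha g x - x.
have step i : (i < T)%N -> (p i <= p (i + s))%N /\
    `|\sum_(f <- F i) (alpha (v * f)%g x - x) - \sum_(f <- F i) (alpha f x - x)| <=
    (eta + eta) *+ p i + (eta + eta) *+ p i +
     ((D + eta) *+ (p (i + s) - p i) + (D + eta) *+ (p (i + s) - p i)).
  move=> iT; have mi := Fmin i (T_lt i iT); have mis := Fmin _ (is_lt i iT).
  have mvi := min_cover_translate v mi.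
  have cov1 : covers W (F (i + s)%N) (A i).
    by move=> a Aa; apply: mis.1; apply: layer_mono Aa; exact: leq_addr.
  have cov2 : covers W (F (i + s)%N) [set (v * a)%g | a in A i].
    by move=> _ [a Aa <-]; apply: mis.1; exact: layer_mul.
  have [t [t_inj tP]] := min_cover_matching (A1 i) mi cov1.
  have [t' [t'_inj t'P]] := min_cover_matching (ex_intro2 _ _ _ (A1 i) erefl) mvi cov2.
  have bd f : f \in F (i + s)%N -> `|alpha f x - x| <= D + eta by exact: FD (is_lt i iT).
  split; first by have := leq_card t t_inj; rewrite !card_ord.
  have h1 := matching_sum_dist alpha_action W_small t_inj tP bd.
  have h2 := matching_sum_dist alpha_action W_small t'_inj t'P bd.
  rewrite big_map size_map in h2.
  rewrite -(subrK (\sum_(f <- F (i + s)%N) (alpha f x - x))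
     (\sum_(f <- F i) (alpha (v * f)%g x - x))) -addrA.
  apply: le_trans (ler_normD _ _) _; rewrite [X in _ + X <= _]distrC.
  by rewrite addrACA; apply: lerD.
rewrite affine_mean //.
have -> : \sum_(f <- Fs) M^-1 *: alpha v (alpha f x) - x' = M^-1 *: \sum_(0 <= i < T)
   (\sum_(f <- F i) (alpha (v * f)%g x - x) - \sum_(f <- F i) (alpha f x - x)).
  rewrite sumrB -!sumFs -sumrB scaler_sumr /x' -sumrB; apply: eq_bigr => f _.
  by rewrite aM -scalerBr opprB addrA subrK.
rewrite normrZ gtr0_norm ?invr_gt0 // ler_pdivrMl //.
apply: le_trans (ler_norm_sum _ _ _) _.
pose q i : R := (p i)%:R.
apply: le_trans (_ : \sum_(0 <= i < T) (4 * eta * q i + 2 * (D + eta) * (q (i + s)%N - q i)) <= _).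
  rewrite big_nat [leRHS]big_nat; apply: ler_sum => i /andP[_ iT].
  have [pi h] := step i iT; apply: le_trans h _; rewrite /q.
  rewrite -(mulr_natr (eta + eta)) -(mulr_natr (D + eta)) natrB //; lra.
rewrite big_split /= -!mulr_sumr sumrB.
have szM : M = \sum_(0 <= i < T) q i by rewrite /M szFs natr_sum.
rewrite -szM.
have shift : \sum_(0 <= i < T) q (i + s)%N <= M + s%:R * ((size hs)%:R * q 0%N).
  rewrite szM -natr_sum -natr_sum -!natrM -natrD ler_nat.
  by apply: sum_shift_le => i iTs; apply: p_le; rewrite -TN; lia.
have MT : T%:R * q 0%N <= M by rewrite /M -natrM ler_nat.
have sTm : s%:R = 2 * 2^-1 ^+ m * T%:R :> R.
  have h : s%:R * 2 ^+ m = 2 * T%:R :> R.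
    by rewrite -natrX -!natrM; congr _%:R; rewrite /s -expnD subnK // mul2n -addnn TN.
  by rewrite exprVn mulrAC -h mulfK // lt0r_neq0 // exprn_gt0.
have e0 : 0 <= D + eta by rewrite addr_ge0.
have h1 : 2 * (D + eta) * (\sum_(0 <= i < T) q (i + s)%N - M) <=
    2 * (D + eta) * (s%:R * ((size hs)%:R * q 0%N)).
  by apply: ler_wpM2l; [rewrite mulr_ge0|rewrite lerBlDl].
have h2 : 2 * (D + eta) * (s%:R * ((size hs)%:R * q 0%N)) <=
    M * (4 * (D + eta) * (size hs)%:R * 2^-1 ^+ m).
  rewrite sTm; set C : R := (size hs)%:R; set z := 2^-1 ^+ m.
  have -> : 2 * (D + eta) * (2 * z * T%:R * (C * q 0%N)) =
     T%:R * q 0%N * (4 * (D + eta) * C * z) by ring.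
  by apply: ler_wpM2r => //; rewrite !mulr_ge0 // exprn_ge0.
rewrite [leRHS]mulrDr; apply: lerD; last exact: le_trans h1 h2.
by rewrite mulrC.
Qed.
End averaging.

(** * Truncating a presentation *)

Local Open Scope group_scope.

Section words.
Variables (G : groupType) (S : set G).
Implicit Types (u v w : word S).

Lemma eval_word_nil : eval_word ([::] : word S) = 1.
Proof. exact: big_nil. Qed.

Lemma eval_word_cons (l : bool * S) w :
  eval_word (l :: w) = (if l.1 then (val l.2)^-1 else val l.2) * eval_word w.
Proof. exact: big_cons. Qed.

Lemma eval_word_cat u v : eval_word (u ++ v) = eval_word u * eval_word v.
Proof. exact: big_cat. Qed.

Definition inv_word (A : Type) (w : word A) : word A :=
  rev [seq (~~ l.1, l.2) | l <- w].

Lemma size_inv_word (A : Type) (w : word A) : size (inv_word w) = size w.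
Proof. by rewrite size_rev size_map. Qed.

Lemma inv_word_cons (A : Type) (l : bool * A) (w : word A) :
  inv_word (l :: w) = inv_word w ++ [:: (~~ l.1, l.2)].
Proof. by rewrite /inv_word /= rev_cons -cats1. Qed.

Lemma eval_inv_word w : eval_word (inv_word w) = (eval_word w)^-1.
Proof.
elim: w => [|[b s] w IH]; first by rewrite eval_word_nil invg1.
rewrite inv_word_cons eval_word_cat IH !eval_word_cons eval_word_nil mulg1 /= invgM.
by case: b; rewrite /= ?invgK.
Qed.
End words.

Section presented.
Variables (A : Type) (rel : set (word A)).
Implicit Types (u v w : word A).
Local Notation "u == v" := (presented_eq rel u v).

Lemma presented_ctx u v w w' : w == w' -> (u ++ w ++ v) == (u ++ w' ++ v).
Proof.
elim=> {w w'} [w|w w' _|w w' w'' _ + _|u' v' b a|u' v' r rr].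
- exact: presented_refl.
- exact: presented_sym.
- exact: presented_trans.
- by have := presented_cancel rel (u ++ u') (v' ++ v) b a; rewrite -!catA.
- by have := presented_relator (u ++ u') (v' ++ v) rr; rewrite -!catA.
Qed.

Lemma presented_cat u u' v v' : u == u' -> v == v' -> (u ++ v) == (u' ++ v').
Proof.
move=> uu' vv'; apply: (presented_trans (w' := u' ++ v)).
  exact: (@presented_ctx [::] v _ _ uu').
by have := @presented_ctx u' [::] _ _ vv'; rewrite !cats0.
Qed.

Lemma presented_mul_inv w : (w ++ inv_word w) == [::].
Proof.
elim: w => [|[b a] w IH]; first exact: presented_refl.
rewrite inv_word_cons /=; apply: (presented_trans (w' := [:: (b, a); (~~ b, a)])).
  by have := @presented_ctx [:: (b, a)] [:: (~~ b, a)] _ _ IH; rewrite /= -catA.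
exact: (presented_cancel rel [::] [::] b a).
Qed.

Lemma inv_wordK : involutive (@inv_word A).
Proof.
move=> w; rewrite /inv_word map_rev revK -map_comp -[RHS]map_id.
by apply: eq_map => -[b a] /=; rewrite negbK.
Qed.

Lemma presented_inv_mul w : (inv_word w ++ w) == [::].
Proof. by rewrite -{2}(inv_wordK w); exact: presented_mul_inv. Qed.

Lemma presented_inv w w' : w == w' -> inv_word w == inv_word w'.
Proof.
move=> ww'; apply: (presented_trans (w' := inv_word w ++ (w' ++ inv_word w'))).
  apply: presented_sym; rewrite -[X in _ == X]cats0.
  apply: presented_cat; [exact: presented_refl|exact: presented_mul_inv].
rewrite catA; apply: (presented_trans (w' := (inv_word w ++ w) ++ inv_word w')).
  apply: presented_cat; last exact: presented_refl.
  apply: presented_cat; [exact: presented_refl|exact: presented_sym].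
by apply: (presented_cat (presented_inv_mul w)); exact: presented_refl.
Qed.
End presented.

Lemma eval_presented (G : groupType) (S : set G) (rel : set (word S)) w w' :
  (forall r, rel r -> eval_word r = 1) -> presented_eq rel w w' ->
  eval_word w = eval_word w'.
Proof.
move=> rel1; elim=> {w w'} // [w w' w'' _ -> _ -> //|u v b a|u v r /rel1 r1].
  rewrite !eval_word_cat !eval_word_cons eval_word_nil mulg1 /=.
  by case: b => /=; rewrite ?mulVg ?mulgV mul1g.
by rewrite !eval_word_cat r1 mul1g.
Qed.

Definition short_relators (G : groupType) (S : set G) (n : nat) : set (word S) :=
  [set r | (size r <= n)%N /\ eval_word r = 1].

(** [w w'^-1] is itself one of the relators. *)
Lemma short_relators_eq (G : groupType) (S : set G) n (w w' : word S) :
  eval_word w = eval_word w' -> (size w + size w' <= n)%N ->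
  presented_eq (short_relators n) w w'.
Proof.
move=> ww' wn; apply: presented_sym.
apply: (presented_trans (w' := (w ++ inv_word w') ++ w')).
  apply: presented_sym.
  apply: (@presented_relator _ _ [::] w' (w ++ inv_word w')); split.
    by rewrite size_cat size_inv_word.
  by rewrite eval_word_cat eval_inv_word ww' mulgV.
rewrite -catA -[X in presented_eq _ _ X]cats0; apply: presented_cat.
  exact: presented_refl.
exact: presented_inv_mul.
Qed.

Section word_length.
Variables (G : groupType) (S : set G).
Hypothesis Sgen : generating S.

Let word_exists g : exists k, `[< exists2 w : word S, eval_word w = g & size w = k >].
Proof. by have [w wg] := Sgen g; exists (size w); apply/asboolP; exists w. Qed.

Definition word_length g := ex_minn (word_exists g).

Lemma word_length_exists g : exists w : word S, eval_word w = g /\ size w = word_length g.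
Proof. by rewrite /word_length; case: ex_minnP => m /asboolP[w] ? ? _; exists w. Qed.

Lemma word_length_le (w : word S) : (word_length (eval_word w) <= size w)%N.
Proof.
rewrite /word_length; case: ex_minnP => m _; apply.
by apply/asboolP; exists w.
Qed.

Lemma word_lengthM g h : (word_length (g * h) <= word_length g + word_length h)%N.
Proof.
have [u [<- <-]] := word_length_exists g; have [v [<- <-]] := word_length_exists h.
by rewrite -eval_word_cat -size_cat; exact: word_length_le.
Qed.

Lemma word_lengthV g : (word_length g^-1 <= word_length g)%N.
Proof.
have [u [<- <-]] := word_length_exists g.
by rewrite -eval_inv_word -size_inv_word; exact: word_length_le.
Qed.

Lemma word_length1 : word_length 1 = 0%N.
Proof. by apply/eqP; rewrite -leqn0 -(eval_word_nil S); exact: word_length_le. Qed.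

Lemma word_length_mem s : S s -> (word_length s <= 1)%N.
Proof.
move=> Ss; have h := word_length_le [:: (false, SigSub (mem_set Ss))].
by rewrite eval_word_cons eval_word_nil mulg1 in h.
Qed.
End word_length.

(* Length 12 accommodates every relator needed for the topology and for
   transporting covers below. *)
Record truncation := Truncation {
  tr_group : topologicalGroupType;
  tr_gens : set tr_group;
  tr_len : nat;
  tr_len_ge : (12 <= tr_len)%N;
  tr_generating : generating tr_gens;
  tr_nbhs : nbhs 1 tr_gens
}.

Arguments tr_gens : clear implicits.
Arguments tr_generating : clear implicits.
Arguments tr_nbhs : clear implicits.

(** * The truncated group and its topology *)

Section truncated.
Variable d : truncation.
Local Notation H := (tr_group d).
Local Notation S := (tr_gens d).
Local Notation n := (tr_len d).
Local Notation W := (word (tr_gens d)).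
Local Notation rel := (short_relators (S := tr_gens d) n).

Definition trunc_equiv (u v : W) := `[< presented_eq rel u v >].
Lemma trunc_refl : reflexive trunc_equiv.
Proof. by move=> u; apply/asboolP; exact: presented_refl. Qed.
Lemma trunc_sym : symmetric trunc_equiv.
Proof. by move=> u v; apply/asboolP/asboolP; exact: presented_sym. Qed.
Lemma trunc_trans : transitive trunc_equiv.
Proof. by move=> u v w /asboolP uv /asboolP vw; apply/asboolP; exact: presented_trans vw. Qed.
Canonical trunc_equivRel := EquivRel trunc_equiv trunc_refl trunc_sym trunc_trans.

Definition trunc := {eq_quot trunc_equiv}%qT.
HB.instance Definition _ := Choice.on trunc.
HB.instance Definition _ := EqQuotient.on trunc.

Definition tpi (w : W) : trunc := \pi w.

Lemma tpiP u v : tpi u = tpi v <-> presented_eq rel u v.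
Proof. by split=> [/eqquotP/asboolP|h]; [exact|apply/eqquotP/asboolP]. Qed.

Lemma trunc_ind (P : trunc -> Prop) : (forall w, P (tpi w)) -> forall g, P g.
Proof. by move=> h g; rewrite -(reprK g); exact: h. Qed.

Definition tmul (g h : trunc) := tpi (repr g ++ repr h).
Definition tinv (g : trunc) := tpi (inv_word (repr g)).
Definition tone := tpi [::].

Lemma repr_tpi w : presented_eq rel (repr (tpi w)) w.
Proof. by apply/tpiP; rewrite /tpi reprK. Qed.

Lemma tmulE u v : tmul (tpi u) (tpi v) = tpi (u ++ v).
Proof. by apply/tpiP; apply: presented_cat; exact: repr_tpi. Qed.
Lemma tinvE u : tinv (tpi u) = tpi (inv_word u).
Proof. by apply/tpiP; apply: presented_inv; exact: repr_tpi. Qed.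

Lemma tmulA : associative tmul.
Proof.
by elim/trunc_ind => u; elim/trunc_ind => v; elim/trunc_ind => w; rewrite !tmulE catA.
Qed.
Lemma tmul1 : left_id tone tmul.
Proof. by elim/trunc_ind => u; rewrite tmulE. Qed.
Lemma tmulr1 : right_id tone tmul.
Proof. by elim/trunc_ind => u; rewrite tmulE cats0. Qed.
Lemma tmulV : left_inverse tone tinv tmul.
Proof. by elim/trunc_ind => u; rewrite tinvE tmulE; apply/tpiP; exact: presented_inv_mul. Qed.
Lemma tmulrV : right_inverse tone tinv tmul.
Proof. by elim/trunc_ind => u; rewrite tinvE tmulE; apply/tpiP; exact: presented_mul_inv. Qed.

HB.instance Definition _ := isGroup.Build trunc tmulA tmul1 tmulr1 tmulV tmulrV.

Lemma tpi_cat u v : tpi (u ++ v) = tpi u * tpi v.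
Proof. by rewrite -tmulE. Qed.
Lemma tpi_nil : tpi [::] = 1.
Proof. by []. Qed.
Lemma tpi_inv u : tpi (inv_word u) = (tpi u)^-1.
Proof. by rewrite -tinvE. Qed.

Lemma tpi_eq u v : eval_word u = eval_word v -> (size u + size v <= n)%N -> tpi u = tpi v.
Proof. by move=> uv uvn; apply/tpiP; exact: short_relators_eq. Qed.

Definition trunc_proj (g : trunc) : H := eval_word (repr g).

Lemma trunc_projE w : trunc_proj (tpi w) = eval_word w.
Proof. by apply: eval_presented (repr_tpi w) => r []. Qed.

Lemma trunc_projM : {morph trunc_proj : g h / g * h}.
Proof.
by elim/trunc_ind => u; elim/trunc_ind => v; rewrite -tpi_cat !trunc_projE eval_word_cat.
Qed.
Lemma trunc_proj1 : trunc_proj 1 = 1.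
Proof. by rewrite -tpi_nil trunc_projE eval_word_nil. Qed.
Lemma trunc_projV g : trunc_proj g^-1 = (trunc_proj g)^-1.
Proof. by elim/trunc_ind: g => u; rewrite -tpi_inv !trunc_projE eval_inv_word. Qed.

Local Notation len := (word_length (tr_generating d)).

Definition lift_word (h : H) : W := projT1 (cid (word_length_exists (tr_generating d) h)).
Lemma eval_lift_word h : eval_word (lift_word h) = h.
Proof. by rewrite /lift_word; case: cid => w []. Qed.
Lemma size_lift_word h : size (lift_word h) = len h.
Proof. by rewrite /lift_word; case: cid => w []. Qed.

(** A set-theoretic section of [trunc_proj], through a chosen shortest word; it will be a local
    inverse of the projection. *)
Definition trunc_lift (h : H) : trunc := tpi (lift_word h).
Local Notation gam := trunc_lift.

Lemma trunc_liftK h : trunc_proj (gam h) = h.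
Proof. by rewrite trunc_projE eval_lift_word. Qed.

(** The words chosen for [g * h], [g] and [h] combine into a relator of length at most
    [2 * (len g + len h)]. *)
Lemma trunc_liftM g h : (2 * (len g + len h) <= n)%N -> gam (g * h) = gam g * gam h.
Proof.
move=> gh; rewrite -tpi_cat; apply: tpi_eq.
  by rewrite eval_word_cat !eval_lift_word.
rewrite size_cat !size_lift_word; have := word_lengthM (tr_generating d) g h; lia.
Qed.

Lemma trunc_lift1 : gam 1 = 1.
Proof.
apply: (mulgI (gam 1)); rewrite -trunc_liftM ?mulg1 //.
by rewrite word_length1.
Qed.

Lemma trunc_liftV g : (4 * len g <= n)%N -> gam g^-1 = (gam g)^-1.
Proof.
move=> gn; apply: (mulgI (gam g)); rewrite -trunc_liftM ?mulgV ?trunc_lift1 //.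
have := word_lengthV (tr_generating d) g; lia.
Qed.

Lemma tpi_letter (l : bool * S) : tpi [:: l] = if l.1 then (gam (val l.2))^-1 else gam (val l.2).
Proof.
have ls : (len (val l.2) <= 1)%N by apply: word_length_mem; exact: set_valP.
have n12 := tr_len_ge d.
have ls' := leq_trans (word_lengthV (tr_generating d) (val l.2)) ls.
have h : tpi [:: l] = gam (if l.1 then (val l.2)^-1 else val l.2).
  apply: tpi_eq.
    by rewrite eval_lift_word eval_word_cons eval_word_nil mulg1.
  rewrite size_lift_word /=; apply: leq_trans n12.
  by case: l.1; rewrite add1n ltnS; [apply: leq_trans ls' _|apply: leq_trans ls _].
rewrite h; case: l.1 => //; rewrite trunc_liftV //; apply: leq_trans n12.
by rewrite -[12%N]/(4 * 3)%N leq_mul2l /=; apply: leq_trans ls _.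
Qed.

(** Inverse letters are covered too: [s^-1] has length at most 1 and [gam] sends it to the inverse
    of [gam s]. *)
Lemma trunc_word_ind (P : trunc -> Prop) : P 1 ->
  (forall h g, (len h <= 1)%N -> P g -> P (gam h * g)) -> forall g, P g.
Proof.
move=> P1 PM; elim/trunc_ind; elim=> [|l w IH]; first by rewrite tpi_nil.
rewrite -[l :: w]/([:: l] ++ w) tpi_cat tpi_letter.
have ls : (len (val l.2) <= 1)%N by apply: word_length_mem; exact: set_valP.
have n12 := tr_len_ge d.
case: l.1; last exact: PM.
rewrite -trunc_liftV; last first.
  apply: leq_trans n12; rewrite -[12%N]/(4 * 3)%N leq_mul2l /=; exact: leq_trans ls _.
by apply: PM => //; apply: leq_trans ls; exact: word_lengthV.
Qed.

Lemma near1_len : \forall h \near (1 : H), (len h <= 1)%N.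
Proof. by apply: filterS (tr_nbhs d) => h; exact: word_length_mem. Qed.

(** This makes the topology below a group topology. Induction on [b] leaves only conjugation by an
    element of length at most 1, for which short relators suffice; the neighbourhood depends on
    [b]. *)
Lemma trunc_conj (b : trunc) : \forall h \near (1 : H),
  b^-1 * gam h * b = gam ((trunc_proj b)^-1 * h * trunc_proj b).
Proof.
have n12 := tr_len_ge d.
elim/trunc_word_ind: b => [|k b lk IH].
  by near=> h; rewrite trunc_proj1 !invg1 !mul1g !mulg1.
have := nbhs1_conj k IH; apply: filterS2 near1_len => h lh hb.
rewrite trunc_projM trunc_liftK !invgM.
have -> : b^-1 * (gam k)^-1 * gam h * (gam k * b) = b^-1 * ((gam k)^-1 * gam h * gam k) * b.
  by rewrite !mulgA.
have lkV := word_lengthV (tr_generating d) k.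
have lkh := word_lengthM (tr_generating d) k^-1 h.
rewrite -trunc_liftV -?trunc_liftM; try by lia.
by rewrite hb !mulgA.
Unshelve. all: by end_near. Qed.

(** The topology is transported from [H] by [gam] near 1 and by left translations elsewhere, so that
    [trunc_proj] becomes a local homeomorphism. *)
Definition trunc_nbhs (g : trunc) : set_system trunc :=
  [set A | \forall h \near (1 : H), A (g * gam h)].
HB.instance Definition _ := hasNbhs.Build trunc trunc_nbhs.

Lemma trunc_nbhsE (g : trunc) (A : set trunc) :
  nbhs g A = \forall h \near (1 : H), A (g * gam h).
Proof. by []. Qed.

Lemma trunc_nbhs_filter (g : trunc) : ProperFilter (nbhs g).
Proof.
have FF : Filter (nbhs g).
  split; rewrite ?trunc_nbhsE; first exact: filterT.
    by move=> A B hA hB; apply: filterI hA hB.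
  by move=> A B AB; apply: filterS => h; exact: AB.
apply: Build_ProperFilter_ex => A gA.
by exists (g * gam 1); exact: (nbhs_singleton (gA : nbhs (1 : H) _)).
Qed.

Lemma trunc_nbhs_singleton (g : trunc) (A : set trunc) : nbhs g A -> A g.
Proof.
by move=> gA; have := nbhs_singleton (gA : nbhs (1 : H) _); rewrite /= trunc_lift1 mulg1.
Qed.

Lemma near1_liftM : \forall h \near (1 : H) & k \near (1 : H),
  gam (h * k) = gam h * gam k.
Proof.
exists (S : set H, S : set H); first by split; exact: tr_nbhs.
move=> [h k] /= [/(word_length_mem (tr_generating d)) lh /(word_length_mem (tr_generating d)) lk].
by apply: trunc_liftM; have := tr_len_ge d; lia.
Qed.

Lemma trunc_nbhs_nbhs (g : trunc) (A : set trunc) : nbhs g A -> nbhs g (nbhs^~ A).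
Proof.
move=> gA; have := @nbhs_mul2 H 1 1 [set h | A (g * gam h)].
rewrite mulg1 => /(_ gA) [V [V' [V1 V'1 VV]]].
have := near1_liftM => -[[P Q] /= [P1 Q1] PQ].
rewrite trunc_nbhsE; apply: filterS (filterI V1 P1) => h [Vh Ph].
rewrite trunc_nbhsE; apply: filterS (filterI V'1 Q1) => k [Vk Qk].
rewrite -mulgA -(PQ (h, k)) //; exact: VV.
Qed.

HB.instance Definition _ := Nbhs_isNbhsTopological.Build trunc
  trunc_nbhs_filter trunc_nbhs_singleton trunc_nbhs_nbhs.

Lemma trunc_mul_continuous : continuous (fun x : trunc * trunc => x.1 * x.2).
Proof.
move=> [a b] A /= abA.
have := @nbhs_mul2 H 1 1 [set h | A (a * b * gam h)].
rewrite mulg1 => /(_ abA) [V [V' [V1 V'1 VV]]].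
have := near1_liftM => -[[P Q] /= [P1 Q1] PQ].
(* Moving [gam h] to the right past [b] turns it into [gam (c h)], and [gam] is multiplicative on
   [c h] and [k]. *)
pose c h := (trunc_proj b)^-1 * h * trunc_proj b.
exists ([set a * gam h | h in [set h | [/\ V (c h), P (c h) & b^-1 * gam h * b = gam (c h)]]],
        [set b * gam h | h in V' `&` Q]) => /=.
  split; rewrite trunc_nbhsE.
    have VP1 : nbhs (1 : H) (V `&` P) by exact: filterI.
    have h1 := @nbhs1_conj H (trunc_proj b) _ VP1.
    apply: filterS2 h1 (trunc_conj b) => h [Vh Ph] ch.
    by exists h.
  by apply: filterS (filterI V'1 Q1) => h Vh; exists h.
move=> [_ _] /= [[h [Vh Ph ch] <-] [k [Vk Qk] <-]].
have -> : a * gam h * (b * gam k) = a * b * gam (c h * k).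
  rewrite (PQ (c h, k)) // -ch !mulgA; congr (_ * _ * _); congr (_ * _).
  by rewrite mulgK.
exact: VV.
Qed.

Lemma trunc_inv_continuous : continuous (fun x : trunc => x^-1).
Proof.
move=> a A /= aA.
(* [(a * gam h)^-1] is [a^-1] times the conjugate of [gam h^-1] by [a^-1], to which [trunc_conj]
   applies. *)
have h0 : nbhs (1 : H) ([set h | A (a^-1 * gam ((trunc_proj a^-1)^-1 * h * trunc_proj a^-1))] `&`
    [set h | (a^-1)^-1 * gam h * a^-1 = gam ((trunc_proj a^-1)^-1 * h * trunc_proj a^-1)]).
  by apply: filterI (trunc_conj a^-1); exact: (@nbhs1_conj H (trunc_proj a^-1) _ aA).
have h1 := nbhs1_inv h0.
apply: filterS2 h1 near1_len => h [/= Ah ch] lh.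
rewrite invgM -trunc_liftV; last by have := tr_len_ge d; lia.
by move: Ah; rewrite -ch invgK !mulgA mulVg mul1g.
Qed.

HB.instance Definition _ := PreTopologicalGroup_isTopologicalGroup.Build trunc
  trunc_mul_continuous trunc_inv_continuous.
End truncated.

Section map_word.
Variables (A B : Type) (f : A -> B).

Definition map_word (w : word A) : word B := [seq (l.1, f l.2) | l <- w].

Lemma presented_eq_map (rel : set (word A)) (rel' : set (word B)) u v :
  (forall r, rel r -> rel' (map_word r)) -> presented_eq rel u v ->
  presented_eq rel' (map_word u) (map_word v).
Proof.
move=> ff; elim=> {u v} [w|u v _|u v w _ + _|u v b a|u v r /ff fr].
- exact: presented_refl.
- exact: presented_sym.
- exact: presented_trans.
- by rewrite /map_word !map_cat; exact: presented_cancel.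
- by rewrite /map_word !map_cat; exact: presented_relator.
Qed.
End map_word.

(** * Local compactness, kernel and presentation of the truncated group *)

Section trunc_properties.
Variable d : truncation.
Local Notation H := (tr_group d).
Local Notation S := (tr_gens d).
Local Notation n := (tr_len d).
Local Notation gam := (@trunc_lift d).
Local Notation pi := (@trunc_proj d).
Local Notation len := (word_length (tr_generating d)).

Lemma trunc_lift_continuous k : (2 * (len k).+1 <= n)%N -> {for k, continuous gam}.
Proof.
move=> kn A /= gA; apply/nbhs_translate.
apply: filterS2 (near1_len d) (gA : nbhs (1 : H) _) => h lh /= Ah.
by rewrite /= trunc_liftM //; lia.
Qed.

Lemma trunc_lift_compact (K : set H) : compact K -> K `<=` S -> compact (gam @` K).
Proof.
move=> Kc KS; apply: continuous_compact => //; apply: continuous_in_subspaceT => k.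
rewrite inE => /KS /(word_length_mem (tr_generating d)) lk.
by apply: trunc_lift_continuous; have := tr_len_ge d; lia.
Qed.

Lemma trunc_proj_continuous : continuous pi.
Proof.
move=> g A /= /nbhs_translate gA.
have : nbhs (1 : H) [set h | A (pi (g * gam h))].
  by apply: filterS gA => h /=; rewrite trunc_projM trunc_liftK.
by [].
Qed.

(** Inseparable points have the same projection since [H] is Hausdorff. Meeting neighbourhoods give
    [a * gam h = b * gam k]; projecting forces [h = k], hence [a = b]. *)
Lemma trunc_hausdorff : hausdorff_space H -> hausdorff_space (trunc d).
Proof.
move=> Hh a b ab.
have pab : pi a = pi b.
  apply: Hh => A B aA bB; have [g [gA gB]] :=
    ab _ _ (trunc_proj_continuous aA) (trunc_proj_continuous bB).
  by exists (pi g).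
have im (c : trunc d) : nbhs c [set c * gam h | h in setT].
  have : nbhs (1 : H) [set h | [set c * gam h' | h' in setT] (c * gam h)].
    by apply: filterS filterT => h _; exists h.
  by [].
have [_ [[h _ <-] [k _ /esym e]]] := ab _ _ (im a) (im b).
have := congr1 pi e; rewrite !trunc_projM !trunc_liftK pab => /mulgI hk.
by move: e; rewrite hk => /mulIg.
Qed.

Lemma trunc_nbhs_lift (g : trunc d) (V : set H) : nbhs (1 : H) V ->
  nbhs g [set g * gam h | h in V].
Proof.
move=> V1; have : nbhs (1 : H) [set h | [set g * gam h' | h' in V] (g * gam h)].
  by apply: filterS V1 => h Vh; exists h.
by [].
Qed.

Lemma trunc_locally_compact (K : set H) : hausdorff_space H ->
  compact K -> nbhs (1 : H) K -> K `<=` S -> locally_compact_group (trunc d).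
Proof.
move=> Hh Kc K1 KS; have th := trunc_hausdorff Hh; split=> // x _; rewrite withinET.
exists [set x * gam h | h in K]; first exact: trunc_nbhs_lift.
have c : compact [set x * gam h | h in K].
  rewrite -(image_comp gam (fun g => x * g)).
  apply: continuous_compact; last exact: trunc_lift_compact.
  apply: continuous_subspaceT; exact: mulgl_continuous.
by split=> //; exact: compact_closed.
Qed.

Definition trunc_ker : set (trunc d) := pi @^-1` [set 1].

Lemma trunc_ker_normal : normal_subgroup trunc_ker.
Proof.
split; first split; rewrite ?inE /=.
- exact: trunc_proj1.
- by move=> x y; rewrite !inE /trunc_ker /= trunc_projM trunc_projV => -> ->; rewrite invg1 mulg1.
- move=> x y; rewrite /trunc_ker /= /conjg !trunc_projM trunc_projV => ->.
  by rewrite mul1g mulVg.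
Qed.

(** As [gam] is a section, the neighbourhood of [x] formed by the [x * gam h] meets the kernel only
    in [x]. *)
Lemma trunc_ker_discrete : discrete_subset trunc_ker.
Proof.
move=> x Nx; split; first by rewrite inE.
exists [set x * gam h | h in setT]; first by apply: trunc_nbhs_lift; exact: filterT.
apply/seteqP; split=> [_ [[h _ <-]]|_ ->].
  by rewrite /trunc_ker /= trunc_projM trunc_liftK Nx mul1g => ->; rewrite trunc_lift1 mulg1.
by split=> //; exists 1 => //; rewrite trunc_lift1 mulg1.
Qed.

Lemma trunc_quotient : is_quotient H trunc_ker.
Proof.
exists pi; split=> //; first exact: trunc_projM.
  by apply/seteqP; split=> // h _; exists (gam h) => //; exact: trunc_liftK.
move=> U; split=> [|oU]; first by move: U; apply/continuousP; exact: trunc_proj_continuous.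
rewrite openE => h Uh; rewrite /interior; apply/nbhs_translate.
have gh : (pi @^-1` U) (gam h) by rewrite /= trunc_liftK.
have : nbhs (1 : H) [set k | U (pi (gam h * gam k))] by exact: (open_nbhs_nbhs (conj oU gh)).
by apply: filterS => k /=; rewrite trunc_projM !trunc_liftK.
Qed.

(** The generators must lie in the group itself, so words over [S] are translated letter by letter
    into words over its image under [gam], by the mutually inverse [f] and [g]. *)
Lemma trunc_compactly_presented : compact S -> compactly_presented (trunc d).
Proof.
move=> Sc; exists (gam @` S); split; first exact: trunc_lift_compact.
pose S' := gam @` S.
have fP (s' : S') : pi (val s') \in S.
  by rewrite inE; have [s Ss <-] := set_valP s'; rewrite trunc_liftK.
have gP (s : S) : gam (val s) \in S'.
  by rewrite inE; exists (val s) => //; exact: set_valP.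
pose f (s' : S') : S := SigSub (fP s').
pose g (s : S) : S' := SigSub (gP s).
have fg s : f (g s) = s by apply/val_inj; rewrite /= trunc_liftK.
have gf s' : g (f s') = s'.
  by apply/val_inj => /=; have [s Ss <-] := set_valP s'; rewrite trunc_liftK.
have mfg w : map_word f (map_word g w) = w.
  rewrite /map_word -map_comp -[RHS]map_id; apply: eq_map => -[b s] /=.
  by rewrite fg.
have mgf w : map_word g (map_word f w) = w.
  rewrite /map_word -map_comp -[RHS]map_id; apply: eq_map => -[b s] /=.
  by rewrite gf.
have ev (w : word S') : eval_word w = tpi (map_word f w).
  elim: w => [|l w IH]; first by rewrite eval_word_nil.
  rewrite eval_word_cons IH -[map_word f (l :: w)]/([:: (l.1, f l.2)] ++ map_word f w).
  rewrite tpi_cat tpi_letter /=.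
  have -> : val l.2 = gam (pi (val l.2)).
    by have [s Ss <-] := set_valP l.2; rewrite trunc_liftK.
  by rewrite trunc_liftK.
exists (short_relators (S := S') n), n; split; first by move=> r [].
split=> [x|w w'].
  by exists (map_word g (repr x)); rewrite ev mfg /tpi generic_quotient.reprK.
split; last by apply: eval_presented => r [].
rewrite !ev => /tpiP h; rewrite -(mgf w) -(mgf w').
apply: presented_eq_map h => r [rn r1]; split; first by rewrite size_map.
by rewrite ev mfg -tpi_nil; apply: tpi_eq; rewrite ?eval_word_nil // addn0.
Qed.
End trunc_properties.

Local Close Scope group_scope.

(** * Proof of the theorem *)

(** Compactness in its near-covering form, for the filter of all sufficiently large lists of
    elements of [K]. The centres are kept in [K] because [gam] is multiplicative only on short
    elements. *)
Lemma compact_translate_cover (G : topologicalGroupType) (K V : set G) :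
  compact K -> nbhs (1%g : G) V ->
  exists2 hs : seq G, (forall h, h \in hs -> K h) & covers V hs K.
Proof.
move=> /compact_near_coveringP Kc V1.
pose inK (hs : seq G) := forall h, h \in hs -> K h.
pose F : set_system (seq G) :=
  [set A | exists2 hs0, inK hs0 & forall hs, inK hs -> {subset hs0 <= hs} -> A hs].
have FF : Filter F.
  split; first by exists [::].
    move=> A B [s sK sA] [t tK tB]; exists (s ++ t).
      by move=> h; rewrite mem_cat => /orP[/sK|/tK].
    move=> hs hsK sub; split; [apply: sA|apply: tB] => // h hh; apply: sub;
      by rewrite mem_cat hh ?orbT.
  by move=> A B AB [s sK sA]; exists s => // hs hsK sub; apply/AB/sA.
have [|hs hsK hscov] := Kc _ F (fun (hs : seq G) k => exists2 h, h \in hs & V (h^-1 * k)%g) FF.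
  move=> x Kx; exists ([set k | V (x^-1 * k)%g], [set hs : seq G | x \in hs]) => /=.
    split; last first.
      exists [:: x]; first by move=> h; rewrite inE => /eqP ->.
      by move=> hs _; apply; rewrite mem_head.
    by apply/nbhs_translate; apply: filterS V1 => v /=; rewrite mulKg.
  by move=> [k hs] /= [Vk xhs]; exists x.
exists hs => //; exact: (hscov hs).
Qed.

Lemma compact_displacement (R : realType) (X : normedModType R)
    (G : topologicalGroupType) (alpha : G -> X -> X) (S : set G) (x : X) :
  continuous (fun p : G * X => alpha p.1 p.2) -> compact S ->
  exists r, forall s, S s -> `|alpha s x - x| <= r.
Proof.
move=> ac Sc; have oc : continuous (fun g => alpha g x).
  move=> g A /= gA; have /= := ac (g, x) A gA.
  move=> [[P Q] /= [gP xQ] PQ]; apply: filterS gP => h Ph.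
  by apply: (PQ (h, x)); split=> //=; exact: nbhs_singleton.
have := continuous_compact (continuous_subspaceT oc) Sc => /compact_bounded [M [_ hM]].
exists (M + 1 + `|x|) => s Ss; apply: le_trans (ler_normB _ _) _; rewrite lerD2r.
by apply: (hM (M + 1)); [rewrite ltrDl|exists s].
Qed.

Lemma orbit_nbhs (R : realType) (X : normedModType R)
    (G : topologicalGroupType) (alpha : G -> X -> X) (x : X) (e : R) :
  affine_isometric_action alpha -> continuous (fun p : G * X => alpha p.1 p.2) ->
  0 < e -> nbhs (1%g : G) [set w | `|alpha w x - x| <= e].
Proof.
move=> [a1 _ _ _] ac e0.
have /= := ac (1%g, x) (ball x e); rewrite a1 => /(_ (nbhsx_ballx _ _ e0)).
move=> [[P Q] /= [P1 xQ] PQ]; apply: filterS P1 => w Pw /=.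
have /= := PQ (w, x) (conj Pw (nbhs_singleton xQ)); rewrite -ball_normE /= distrC.
exact: ltW.
Qed.

Lemma rescaled_action (R : realType) (X : normedModType R) (G : groupType)
    (alpha : G -> X -> X) (r : R) (x : X) : 0 < r ->
  affine_isometric_action alpha ->
  affine_isometric_action (fun g y => r^-1 *: (alpha g (r *: y + x) - x)).
Proof.
move=> r0 [a1 aM aA aI]; have rn0 : r != 0 by rewrite gt_eqF.
split=> [y|g h y|g t y z|g y z].
- by rewrite a1 addrK scalerA mulVf // scale1r.
- by rewrite scalerA mulfV // scale1r subrK aM.
- have -> : r *: (t *: y + (1 - t) *: z) + x = t *: (r *: y + x) + (1 - t) *: (r *: z + x).
    rewrite !scalerDr addrACA -scalerDl [t + _]addrC subrK scale1r !scalerA.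
    by rewrite ![r * _]mulrC.
  rewrite aA !scalerA ![_ * r^-1]mulrC -!scalerA -scalerDr; congr (_ *: _).
  rewrite !scalerBr addrACA; congr (_ + _).
  by rewrite -opprD -scalerDl [t + _]addrC subrK scale1r.
- by rewrite -scalerBr opprB addrA subrK normrZ gtr0_norm ?invr_gt0 // aI opprD addrACA subrr
    addr0 -scalerBr normrZ gtr0_norm // mulKf.
Qed.

(** * Rescaled actions with controlled base points *)

Section seed.
Variables (R : realType) (d : truncation).
Local Notation H := (tr_group d).
Local Notation S := (tr_gens d).
Local Notation gam := (@trunc_lift d).
Variables (K : set H) (V : nat -> set H) (hs : seq H) (m : nat).
Hypotheses (S_compact : compact S) (K_compact : compact K) (KS : K `<=` S).
Hypothesis V1 : forall k, V k 1%g.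
Hypothesis VK : forall k, V k `<=` K.
Hypothesis VVK : forall a b, V 0%N a -> V 0%N b -> K (a * b)%g.
Hypothesis V3 : forall k a b c,
  V k.+1 a -> V k.+1 b -> V k.+1 c -> V k (a * b * c)%g.
Hypothesis hsK : forall h, h \in hs -> K h.
Hypothesis hs_covers : covers (V 0%N) hs K.
Variables (X : completeNormedModType R) (alpha : trunc d -> X -> X).
Hypothesis alpha_action : affine_isometric_action alpha.
Hypothesis alpha_continuous : continuous (fun p : trunc d * X => alpha p.1 p.2).
Hypothesis alpha_nofix : ~ (exists x, forall g, alpha g x = x).

Let len1 k : K k -> (word_length (tr_generating d) k <= 1)%N.
Proof. by move=> /KS; exact: word_length_mem. Qed.

Let gamM a b : K a -> K b -> gam (a * b)%g = (gam a * gam b)%g.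
Proof.
by move=> /len1 la /len1 lb; apply: trunc_liftM; have := tr_len_ge d; lia.
Qed.

(** [beta] is [alpha] recentred at the averaged point [x'] and divided by [r]. The bound 5 is 2 + 1
    + 2, since passing between [x] and [x'] costs at most [2 * r] each way. The last bound depends
    on [k] and [hs] only, up to a term vanishing with [m]. *)
Lemma seed_action : exists beta : trunc d -> X -> X,
  [/\ affine_isometric_action beta,
      forall s, S s -> `|beta (gam s) 0| <= 5,
      forall y, `|y| <= m%:R -> exists2 s, S s & 2^-1 < `|beta (gam s) y - y| &
      forall k v, (0 < k <= m)%N -> V k v ->
        `|beta (gam v) 0| <= 4 * m.+1%:R^-1 + 8 * (size hs)%:R * 2^-1 ^+ k].
Proof.
have n12 := tr_len_ge d.
have bd x : exists r, forall s, (gam @` S) s -> `|alpha s x - x| <= r.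
  by apply: compact_displacement => //; exact: trunc_lift_compact.
have gen : generating (gam @` S).
  elim/trunc_word_ind => [|h g lh [w <-]]; first by exists [::]; rewrite eval_word_nil.
  move: lh; have [u [<- <-]] := word_length_exists (tr_generating d) h.
  case: u => [|l [|l' u]] //= _.
    by exists w; rewrite eval_word_nil trunc_lift1 mul1g.
  have Sl : (val l.2) \in S by case: (l.2).
  have gS : gam (val l.2) \in gam @` S by rewrite inE; exists (val l.2) => //; rewrite -inE.
  exists ((l.1, SigSub gS) :: w); rewrite eval_word_cons; congr (_ * _)%g.
  rewrite eval_word_cons eval_word_nil mulg1 /=.
  have ll : (word_length (tr_generating d) (val l.2) <= 1)%N.
    by apply: word_length_mem; rewrite -inE.
  case: l.1 => //; rewrite trunc_liftV //; apply: leq_trans n12.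
  by rewrite -[12%N]/(4 * 3)%N leq_mul2l /=; apply: leq_trans ll _.
(* The radius is [m] after rescaling, plus 2 for replacing [x] by [x']. *)
have m2 : 0 < (m%:R + 2 : R) by rewrite ltr_wpDl.
have [x [r [r0 xr xmv]]] := rough_point_selection alpha_action gen bd alpha_nofix m2.
(* After division by [r] this contributes [m.+1%:R^-1], negligible in the limit. *)
pose eta : R := m.+1%:R^-1 * r.
have m10 : 0 < (m.+1%:R^-1 : R) by rewrite invr_gt0 ltr0n.
have eta0 : 0 < eta by rewrite mulr_gt0.
have eta1 : eta <= r by rewrite /eta ger_pMl // invf_le1 ?ltr0n // ler1n.
pose W := [set w | `|alpha w x - x| <= eta].
have W1 : nbhs (1%g : trunc d) W by exact: orbit_nbhs.
have [F0 _ F0cov] := compact_translate_cover (trunc_lift_compact K_compact KS) W1.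
pose V' k := gam @` (V k).
have V00 g : (exists a b, [/\ V' 0%N a, V' 0%N b & g = (a * b)%g]) -> (gam @` K) g.
  move=> [_ [_ [[a Va <-] [b Vb <-] ->]]]; exists (a * b)%g; first exact: VVK.
  exact: gamM (VK Va) (VK Vb).
(* The number of levels is [m.+1], positive even for [m = 0]. *)
have [|||||||x' [x'x x'v]] := @almost_invariant_mean R X (trunc d) alpha x W eta r V' m.+1 F0
   [seq gam h | h <- hs] alpha_action.
- by [].
- by move=> k; exists 1%g => //; exact: trunc_lift1.
- move=> k _ _ _ _ [a Va <-] [b Vb <-] [c Vc <-]; exists (a * b * c)%g; first exact: V3.
  rewrite trunc_liftM ?(gamM (VK Va) (VK Vb)) //.
  apply: leq_trans n12; rewrite -[12%N]/(2 * 6)%N; apply: (@leq_trans (2 * (2 + 1))%N) => //.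
  rewrite leq_mul2l /=; apply: leq_add (len1 (VK Vc)).
  apply: leq_trans (word_lengthM _ _ _) _.
  exact: leq_add (len1 (VK Va)) (len1 (VK Vb)).
- by [].
- by move=> g /V00; exact: F0cov.
- move=> g /V00 [k Kk <-]; have [h hh hk] := hs_covers Kk.
  exists (gam h); first exact: map_f.
  exists (h^-1 * k)%g => //; apply: (mulgI (gam h)).
  by rewrite -gamM ?mulVKg //; [exact: hsK|exact: VK hk].
- by move=> g /V00 [k Kk <-]; apply: xr; exists k => //; exact: KS.
have [a1 aM aA aI] := alpha_action.
have x'2 : `|x' - x| <= 2 * r by apply: le_trans x'x _; lra.
exists (fun g y => r^-1 *: (alpha g (r *: y + x') - x')); split.
- exact: rescaled_action.
- move=> s Ss; rewrite scaler0 add0r normrZ gtr0_norm ?invr_gt0 // ler_pdivrMl //.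
  have -> : alpha (gam s) x' - x' =
      (alpha (gam s) x' - alpha (gam s) x) + (alpha (gam s) x - x) - (x' - x).
    by rewrite addrA subrK opprB addrA subrK.
  apply: le_trans (ler_normB _ _) _; apply: le_trans (lerD (ler_normD _ _) (lexx _)) _.
  rewrite aI; have : `|alpha (gam s) x - x| <= r by apply: xr; exists s.
  lra.
- move=> y ym; have [|_ [s Ss <-] hs'] := xmv (r *: y + x').
    rewrite -addrA; apply: le_trans (ler_normD _ _) _.
    rewrite normrZ gtr0_norm // mulrDl; apply: lerD => //.
    by rewrite mulrC ler_wpM2r // ltW.
  exists s => //.
  have -> : r^-1 *: (alpha (gam s) (r *: y + x') - x') - y =
      r^-1 *: (alpha (gam s) (r *: y + x') - (r *: y + x')).
    by rewrite opprD [- (r *: y) - x']addrC addrA [RHS]scalerBr scalerA mulVf ?gt_eqF // scale1r.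
  by rewrite normrZ gtr0_norm ?invr_gt0 // ltr_pdivlMl.
- move=> k v /andP[k0 km] Vv; rewrite scaler0 add0r normrZ gtr0_norm ?invr_gt0 //.
  rewrite ler_pdivrMl //.
  have := x'v k (gam v); rewrite k0 (leqW km) size_map => /(_ isT (ex_intro2 _ _ v Vv erefl)) h.
  apply: le_trans h _; rewrite [leRHS]mulrDr; apply: lerD.
    by rewrite /eta mulrA mulrC.
  set z := 2^-1 ^+ k; set C : R := (size hs)%:R.
  have zC : 0 <= C * z by rewrite mulr_ge0 // exprn_ge0.
  have := ler_wpM2r zC eta1; rewrite /z /C.
  set w := _ * _ ^+ k => h.
  have -> : 4 * (r + eta) * (size hs)%:R * 2^-1 ^+ k =
      4 * (r * w) + 4 * (eta * w) by rewrite /w; ring.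
  have -> : r * (8 * (size hs)%:R * 2^-1 ^+ k) = 8 * (r * w) by rewrite /w; ring.
  lra.
Qed.
End seed.

(** Triple products are what the halving argument of [wprod_small] consumes: a prefix, one letter
    and a suffix. *)
Lemma shrinking_nbhs (G : topologicalGroupType) (K : set G) : nbhs (1%g : G) K ->
  exists V : nat -> set G, [/\ forall k, nbhs (1%g : G) (V k), forall k, V k `<=` K,
    forall a b, V 0%N a -> V 0%N b -> K (a * b)%g &
    forall k a b c, V k.+1 a -> V k.+1 b -> V k.+1 c -> V k (a * b * c)%g].
Proof.
move=> K1.
have /choice [f fP] : forall A : set G, exists B : set G, nbhs (1%g : G) A ->
    [/\ nbhs (1%g : G) B, B `<=` A & forall x y z, B x -> B y -> B z -> A (x * y * z)%g].
  move=> A; have [A1|nA] := pselect (nbhs (1%g : G) A); last by exists A => /nA.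
  by have [B hB] := nbhs1_cube A1; exists B.
pose V := fix V k := if k is k'.+1 then f (V k') else f K.
have V1 k : nbhs (1%g : G) (V k).
  by elim: k => [|k IH] /=; [have [] := fP K K1|have [] := fP _ IH].
exists V; split=> //.
- by elim=> [|k IH] /=; [have [] := fP K K1|have [_ h _] := fP _ (V1 k) => x /h /IH].
- move=> a b Va Vb; have [_ _ h] := fP K K1; rewrite -(mulg1 (a * b)%g).
  by apply: h => //; exact: nbhs_singleton (V1 0%N).
- by move=> k a b c; have [_ _ h] := fP _ (V1 k); exact: h.
Qed.

Theorem corollary5p13 (R : realType) (E : completeNormedModType R -> Prop)
    (E_superreflexive : forall X : completeNormedModType R,
       E X -> superreflexive X)
    (E_closed : closed_under_finite_representability E)
    (H : topologicalGroupType)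
    (H_lc : locally_compact_group H)
    (H_cg : compactly_generated H)
    (H_F : property_F E H) :
  exists (G : topologicalGroupType) (N : set G),
    locally_compact_group G /\ compactly_presented G /\ property_F E G /\
    normal_subgroup N /\ discrete_subset N /\ is_quotient H N.
Proof.
have [H_haus H_lc'] := H_lc.
have [S0 [S0c S0gen]] := H_cg.
have [K K1 [Kc _]] : exists2 K : set H, nbhs (1%g : H) K & compact K /\ closed K.
  by have := H_lc' 1%g I; rewrite withinET.
(* A compact neighbourhood of 1 joins the generators, as the topology of the truncated groups
   requires. *)
pose S := S0 `|` K.
have Sc : compact S by exact: compactU.
have KS : K `<=` S by move=> x; right.
have Sgen : generating S.
  move=> g; have [w <-] := S0gen g.
  have inS (s : S0) : val s \in S by rewrite inE; left; exact: set_valP.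
  exists (map_word (fun s => SigSub (inS s)) w).
  by elim: w => [|l w IH]; rewrite ?eval_word_nil // !eval_word_cons IH.
have S1 : nbhs (1%g : H) S by apply: filterS K1.
pose d m := @Truncation H S (m + 12) (leq_addl m 12) Sgen S1.
(* [V] and [hs] depend on [H] alone, which makes the estimates below uniform in [m]. *)
have [V [V1 VK VVK V3]] := shrinking_nbhs K1.
have [hs hsK hscov] := compact_translate_cover Kc (V1 0%N).
have V11 k : V k 1%g by exact: nbhs_singleton.
(* If the conclusion fails, no truncated group has (F_E), since each of them has all the other
   properties. *)
apply: contrapT => noG.
have noF m : ~ property_F E (trunc (d m)).
  move=> FG; apply: noG; exists (trunc (d m)), (@trunc_ker (d m)); split.
    exact: (@trunc_locally_compact (d m) K).
  split; first exact: (@trunc_compactly_presented (d m)).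
  split=> //; split; first exact: trunc_ker_normal.
  by split; [exact: trunc_ker_discrete|exact: (@trunc_quotient (d m))].
have seed m : exists (X : completeNormedModType R), E X /\
    exists beta : trunc (d m) -> X -> X,
  [/\ affine_isometric_action beta,
      forall s, S s -> `|beta (@trunc_lift (d m) s) 0| <= 5,
      forall y, `|y| <= m%:R -> exists2 s, S s & 2^-1 < `|beta (@trunc_lift (d m) s) y - y| &
      forall k v, (0 < k <= m)%N -> V k v ->
        `|beta (@trunc_lift (d m) v) 0| <= 4 * m.+1%:R^-1 + 8 * (size hs)%:R * 2^-1 ^+ k].
  have /existsNP [X /not_implyP [EX /existsNP [alpha /not_implyP [aact /not_implyP [acont nofix]]]]]
    := noF m.
  exists X; split=> //.
  exact: (@seed_action R (d m) K V hs m Sc Kc KS V11 VK VVK V3 hsK hscov X alpha).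
have [X hX] := choice seed.
pose beta m := projT1 (cid (hX m).2).
have bP m : [/\ affine_isometric_action (beta m),
      forall s, S s -> `|beta m (@trunc_lift (d m) s) 0| <= 5,
      forall y, `|y| <= m%:R -> exists2 s, S s & 2^-1 < `|beta m (@trunc_lift (d m) s) y - y| &
      forall k v, (0 < k <= m)%N -> V k v ->
        `|beta m (@trunc_lift (d m) v) 0| <= 4 * m.+1%:R^-1 + 8 * (size hs)%:R * 2^-1 ^+ k].
  exact: projT2 (cid (hX m).2).
pose gam m := @trunc_lift (d m); pose A m h := beta m (gam m h).
pose len := word_length Sgen.
have gamM m g h : (2 * (len g + len h) <= m + 12)%N -> gam m (g * h)%g = (gam m g * gam m h)%g.
  exact: (@trunc_liftM (d m)).
have A_mul k : exists N, forall n, (N <= n)%N -> forall g h, (len g <= k)%N ->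
    (len h <= k)%N -> forall y, A n (g * h)%g y = A n g (A n h y).
  (* The relators involved have length at most [4 * k]. *)
  exists (4 * k)%N => n nk g h gk hk y; have [[_ aM _ _] _ _ _] := bP n.
  rewrite /A gamM ?aM //; apply: leq_trans (leq_mul (leqnn 2) (leq_add gk hk)) _.
  by apply: leq_trans (leq_addr _ _); lia.
have A_equi (e : R) : 0 < e -> exists W N, nbhs (1%g : H) W /\
    forall n, (N <= n)%N -> forall v, W v -> `|A n v 0| <= e.
  move=> e0; pose C : R := (size hs)%:R.
  have C0 : 0 < 16 * (C + 1) by rewrite mulr_gt0 // ltr_wpDl.
  have [k ke] := half_exp_lt (divr_gt0 e0 C0).
  have [N Ne] := ltr_add_invr (y := 0) (x := e / 8) (divr_gt0 e0 (ltr0Sn R 7)).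
  (* On [V k.+1] the term with [hs] is at most [e / 2] whatever [n], the averaging error is so for
     [n >= N], and [k < n] makes the level [k.+1] available. *)
  exists (V k.+1), (maxn N k.+1); split=> // n; rewrite geq_max => /andP[Nn kn] v Vv.
  have [_ _ _ /(_ k.+1 v) h] := bP n; apply: le_trans (h _ Vv) _; first by rewrite kn.
  have h1 : 4 * n.+1%:R^-1 <= e / 2.
    have : n.+1%:R^-1 <= e / 8.
      apply: le_trans (ltW _); last by move: Ne; rewrite add0r; exact.
      by rewrite lef_pV2 ?posrE ?ltr0n // ler_nat.
    by set z := _^-1; lra.
  have h2 : 8 * C * 2^-1 ^+ k.+1 <= e / 2.
    have z0 : 0 < (2^-1 : R) ^+ k by rewrite exprn_gt0.
    move: ke; rewrite ltr_pdivlMr // exprS => ke.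
    have Cz : 0 <= C * 2^-1 ^+ k by rewrite mulr_ge0 // ltW.
    have -> : 8 * C * (2^-1 * 2^-1 ^+ k) = 4 * (C * 2^-1 ^+ k) by field.
    move: ke; rewrite mulrCA mulrDr mulr1 [_ * C]mulrC; lra.
  by apply: le_trans (lerD h1 h2) _; lra.
have A_bounded h : exists M N, forall n, (N <= n)%N -> `|A n h 0| <= M.
  (* Each letter of a word for [h] adds at most 5 to the bound, whatever [n]. *)
  have [w <-] := Sgen h; elim: w => [|l w [M [N hN]]].
    exists 0, 0%N => n _; have [[a1 _ _ _] _ _ _] := bP n.
    by rewrite eval_word_nil /A /gam trunc_lift1 a1 normr0.
  have Ss : S (val l.2) by exact: set_valP.
  have [N' hN'] := A_mul (1 + len (eval_word w))%N.
  exists (M + 5), (maxn N N') => n; rewrite geq_max => /andP[Nn N'n].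
  have [[a1 aM _ aI] a5 _ _] := bP n.
  have ls : (len (val l.2) <= 1)%N by exact: word_length_mem.
  have lV := leq_trans (word_lengthV Sgen (val l.2)) ls.
  pose t := if l.1 then (val l.2)^-1%g else val l.2.
  have lt : (len t <= 1)%N by rewrite /t; case: l.1.
  have t5 : `|A n t 0| <= 5.
    rewrite /t; case: l.1; last exact: a5.
    have -> : A n (val l.2)^-1%g 0 = beta n (gam n (val l.2))^-1%g 0.
      rewrite /A /gam trunc_liftV //; apply: (@leq_trans (4 * 1)%N); last first.
        exact: (leq_trans (isT : (4 * 1 <= 12)%N) (leq_addl n 12)).
      by rewrite leq_mul2l.
    (* By isometry an inverse letter moves 0 exactly as far as the letter itself. *)
    rewrite -[X in `|X|]subr0 -(aI (gam n (val l.2))) -aM mulgV a1 distrC subr0.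
    exact: a5.
  have l1 : (len t <= 1 + len (eval_word w))%N by exact: leq_trans lt (leq_addr _ _).
  rewrite eval_word_cons -/t (hN' _ N'n _ _ l1 (leq_addl _ _)).
  rewrite -(subrK (A n t 0) (A n t _)); apply: le_trans (ler_normD _ _) (lerD _ t5).
  by rewrite aI subr0; exact: hN.
have [U [UU Ufree]] := ultraFilterLemma (F := \oo) _.
have U_free k : U [set n | (k <= n)%N] by apply: Ufree; exists k.
have := @property_F_limit R H S len Sc S1 (word_length_mem Sgen) (word_lengthM Sgen)
  (word_lengthV Sgen) X A _ _ A_mul A_equi A_bounded U UU U_free E E_closed (fun m => (hX m).1) H_F.
apply.
- by move=> n h; have [[_ _ aA _] _ _ _] := bP n; exact: aA.
- by move=> n h x y; have [[_ _ _ aI] _ _ _] := bP n; exact: aI.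
(* From this index on, the ball of radius [n] contains the ball of radius [r]. *)
move=> r; exists (Num.truncn r).+1 => n rn x xr; have [_ _ mv _] := bP n.
by apply: mv; apply: le_trans xr _; apply: ltW; apply: lt_le_trans (truncnS_gt r) _;
  rewrite ler_nat.
Qed.
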